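(* Let $A$ be a reflexive Banach space with a 1-unconditional basis. Then there exist a block subspace $B$ of $A$ (with its normalized block basis) and a null sequence $\mathbf{a}$ of positive real numbers such that the set $W$ in the space $X_B$ is an $\mathbf{a}$-thin subset of $X_B$.
   Context: A block subspace of $A$ is the closed linear span of a sequence of normalized vectors with finite successive supports with respect to the basis of $A$ (its block basis). For a Banach space $B$ with a 1-unconditional basis $(e_n)_{n\ge1}$, the space $X_B$ and the set $W\subset X_B$ are defined as follows. Let $\mathfrak{D}$ be the tree of all finite non-empty sequences $\delta=(k_1,\dots,k_n)$, $n\ge1$, of integers with $0\le k_i\le3^{4i}$, ordered by initial segments; put $|\delta|=n$. Let $c_{00}(\mathfrak{D})$ be the space of finitely supported functions on $\mathfrak{D}$ with unit vectors $(e_\delta)_{\delta\in\mathfrak{D}}$, and let $X_B$ be its completion under the norm $$\Big\|\sum_\delta\lambda_\delta e_\delta\Big\|=\Big\|\sum_{n\ge1}\Big(\sum_{|\delta|=n}|\lambda_\delta|\Big)e_n\Big\|_B .$$ A branch is an infinite sequence $\gamma=(k_i)_{i\ge1}$ with $0\le k_i\le3^{4i}$; put $x_\gamma=\sum_{n\ge1}\frac{k_n}{3^{4n}}e_{(k_1,\dots,k_n)}$ whenever this series converges in $X_B$. Let $K=\{x_\gamma:\gamma\text{ a branch},\ \|x_\gamma\|\le1\}$ and $W=\overline{\mathrm{co}}(K\cup-K)$. For a null sequence $\mathbf{a}=(a_n)$ of positive reals, a non-empty bounded convex symmetric subset $W$ of a Banach space $X$ is $\mathbf{a}$-thin if for every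 infinite dimensional closed subspace $V$ of $X$, $\sup_n\sup_{y\in B_V}\|y\|_n=\infty$, where $\|\cdot\|_n$ is the Minkowski gauge of $2^nW+a_nB_X$. *)

(* Defs.v *)
From HB Require Import structures.
From mathcomp Require Import all_boot all_order all_algebra finmap.
From mathcomp Require Import all_classical all_reals all_analysis.
Set Implicit Arguments.
Unset Strict Implicit.
Unset Printing Implicit Defensive.
Import Order.TTheory GRing.Theory Num.Theory.
Import numFieldNormedType.Exports.
Local Open Scope classical_set_scope.
Local Open Scope ring_scope.

(* Banach spaces are real: [completeNormedModType R] with [R : realType].     *)
(* Sequences indexed by n >= 1 in the mathematics are indexed by [nat] here,  *)
(* the entry [n : nat] standing for the (n+1)-st term.                        *)

Definition unit_ball (R : realType) (X : normedModType R) : set X :=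
  [set x | `|x| <= 1].
Arguments unit_ball {R} X.

Section Reflexivity.
Variables (R : realType) (A : normedModType R).

Definition dual : set (A -> R) :=
  [set phi | linear (phi : A -> R^o) /\ continuous phi].

Definition dual_norm (phi : A -> R) : R :=
  sup [set `|phi x| | x in unit_ball A].

(* Bounded linear functionals on the dual; only the values on [dual] matter.  *)
Definition bidual : set ((A -> R) -> R) :=
  [set F | (forall (c : R) (phi psi : A -> R), dual phi -> dual psi ->
              F (fun x => c * phi x + psi x) = c * F phi + F psi) /\
           (exists C : R, forall phi, dual phi ->
              `|F phi| <= C * dual_norm phi)].

Definition reflexive_space : Prop :=
  forall F, bidual F -> exists x : A, forall phi, dual phi -> F phi = phi x.

End Reflexivity.

Section Bases.
Variables (R : realType) (A : normedModType R).

Definition expansion (e : nat -> A) (x : A) : set (nat -> R) :=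
  [set c | series (fun i => c i *: e i) @ \oo --> x].

Definition schauder_basis (e : nat -> A) : Prop :=
  forall x, exists! c, expansion e x c.

Definition one_unconditional_basis (e : nat -> A) : Prop :=
  schauder_basis e /\
  forall (n : nat) (c : nat -> R) (s : nat -> bool),
    `| \sum_(i < n) ((-1) ^+ s i * c i) *: e i | = `| \sum_(i < n) c i *: e i |.

Definition coords (e : nat -> A) (x : A) : nat -> R :=
  xget (fun=> 0) (expansion e x).

Definition basis_support (e : nat -> A) (x : A) : set nat :=
  [set i | coords e x i != 0].

Definition closed_span (b : nat -> A) : set A :=
  closure [set x | exists n (c : nat -> R), x = \sum_(i < n) c i *: b i].

Definition normalized_block_sequence (e b : nat -> A) : Prop :=
  [/\ forall n, `|b n| = 1,
      forall n, finite_set (basis_support e (b n)) &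
      forall m n i j, (m < n)%N ->
        basis_support e (b m) i -> basis_support e (b n) j -> (i < j)%N].

(* [B] is the block subspace of [A] with normalized block basis [b].          *)
Definition block_subspace (e : nat -> A) (B : set A) (b : nat -> A) : Prop :=
  normalized_block_sequence e b /\ B = closed_span b.

End Bases.

Definition in_tree (s : seq nat) : bool :=
  (s != [::]) &&
  all (fun i => nth 0%N s i <= 3 ^ (4 * i.+1))%N (iota 0 (size s)).

Definition tree : countType := {s : seq nat | in_tree s}.

Definition depth (d : tree) : nat := size (val d).

Definition branch : Type :=
  {g : nat -> nat | forall i, (g i <= 3 ^ (4 * i.+1))%N}.

Lemma in_tree_mkseq (g : branch) (n : nat) : in_tree (mkseq (sval g) n.+1).
Proof.
apply/andP; split; first by [].
apply/allP => i; rewrite mem_iota size_mkseq add0n => /andP[_ lt_in].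
by rewrite nth_mkseq //; exact: (svalP g).
Qed.

Definition prefix_node (g : branch) (n : nat) : tree :=
  exist _ (mkseq (sval g) n.+1) (in_tree_mkseq g n).

Definition c00 (R : realType) : Type := {fsfun tree -> R with 0}.

Section SpaceXB.
Variables (R : realType) (E : normedModType R).

(* [b] is a 1-unconditional basis of a Banach space B; B may be given as a    *)
(* closed subspace of [E] carrying the norm of [E].  The outer sum stops at   *)
(* the largest depth in the support.                                          *)
Definition c00_norm (b : nat -> E) (f : c00 R) : R :=
  `| \sum_(n < \max_(d <- finsupp f) depth d)
       (\sum_(d <- finsupp f | depth d == n.+1) `|f d|) *: b n |.

Definition c00_comb (X : normedModType R) (u : tree -> X) (f : c00 R) : X :=
  \sum_(d <- finsupp f) f d *: u d.

(* The Banach space [X] is a completion of c00 of the tree for [c00_norm b]:  *)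
(* [c00_comb u] is the canonical linear isometry with dense range, and [u d]  *)
(* is the image of the unit vector at [d].                                    *)
Definition is_XB (b : nat -> E) (X : completeNormedModType R) (u : tree -> X) :
    Prop :=
  (forall f : c00 R, `|c00_comb u f| = c00_norm b f) /\
  closure (range (c00_comb u)) = setT.

End SpaceXB.

Section SetW.
Variables (R : realType) (X : normedModType R) (u : tree -> X).

Definition setK : set X :=
  [set x | `|x| <= 1 /\ exists g : branch,
     series (fun n => ((sval g n)%:R / (3 ^+ (4 * n.+1) : R)) *:
                        u (prefix_node g n)) @ \oo --> x].

Definition convex_hull (S : set X) : set X := smallest (@convex_set R X) S.

Definition setW : set X :=
  closure (convex_hull (setK `|` [set - x | x in setK])).

End SetW.

Section Thin.
Variables (R : realType) (X : normedModType R).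

Definition linear_subspace (V : set X) : Prop :=
  V 0 /\ forall (c : R) x y, V x -> V y -> V (c *: x + y).

Definition infinite_dimensional (V : set X) : Prop :=
  ~ exists (n : nat) (v : 'I_n -> X),
      V `<=` [set x | exists c : 'I_n -> R, x = \sum_(i < n) c i *: v i].

Definition minkowski_gauge (C : set X) (y : X) : R :=
  inf [set t | 0 < t /\ exists2 z, C z & y = t *: z].

Definition fattened (W : set X) (r s : R) : set X :=
  [set r *: w + s *: z | w in W & z in unit_ball X].

Definition null_positive (a : nat -> R) : Prop :=
  (forall n, 0 < a n) /\ a @ \oo --> (0 : R).

(* [a n] stands for a_(n+1), hence the factor 2 ^+ n.+1.                      *)
Definition thin (a : nat -> R) (W : set X) : Prop :=
  [/\ W !=set0, bounded_set W, convex_set W & forall x, W x -> W (- x)] /\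
  forall V : set X, linear_subspace V -> closed V -> infinite_dimensional V ->
    ereal_sup [set ereal_sup
      [set (minkowski_gauge (fattened W (2 ^+ n.+1) (a n)) y)%:E
         | y in V `&` unit_ball X] | n in [set: nat]] = +oo%E.

End Thin.

(* Main.v *)
From HB Require Import structures.
Require Import Defs.
From mathcomp Require Import all_boot all_order all_algebra finmap.
From mathcomp Require Import all_classical all_reals all_analysis.
From mathcomp Require Import ring lra.
Set Implicit Arguments.
Unset Strict Implicit.
Unset Printing Implicit Defensive.
Import Order.TTheory GRing.Theory Num.Theory.
Import numFieldNormedType.Exports.
Local Open Scope classical_set_scope.
Local Open Scope ring_scope.

(** Finitely supported sequences are represented by polynomials, the coefficient
    of ['X^i] being the entry of index [i].

    Let [V] be an infinite dimensional subspace of [X_B]. If a vector [y] of [V]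
    with [|y| <= 1] and a functional [F] of norm at most 1 satisfy
    [F y >= 1/16] and [|F| <= eps] on [K], then [y = t (2^n w + a_n z)] with [w]
    in [W] and [|z| <= 1] forces [1/16 <= t (2^n eps + a_n)]. As [eps] is
    arbitrary, the gauge of [y] is at least of the order of [1/a_n]. Any
    null sequence therefore serves, and everything rests on finding [y] and [F]
    ([thin_witness]).

    Take unit vectors [v_j] of [V] that are almost supported on successive
    blocks of levels of the tree, and let [w_j] be the block vector of [B] that
    records the norms of [v_j] on the levels. Suppose that there are
    [y = sum a_j w_j] of norm 1 and a nonnegative functional [phi] of norm at
    most 1 on [B] with [phi y >= 1/2] and with norm at most [delta] on each
    single block ([flat_functional]). Lift [phi] to the tree, aligned with the
    signs of the coefficients of the [v_j]. On a branch that defines an element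
    of [K] the values [g_j] of the successive blocks of the lifted functional
    satisfy [|g_j| <= delta] and [sum |g_j| <= 1], hence [sum g_j^2 <= delta].
    If the blocks are multiplied by random signs, the partial sums along a given
    branch are therefore unlikely ever to exceed a fixed [eta]. The coefficients
    of [x_gamma] up to a node depend only on the path to that node, so the
    functional can be set to 0 at all nodes where the partial sum along the path
    has already exceeded [eta]. It is then at most [eta + delta] on every branch
    and keeps at least half of its value at [sum c_j a_j v_j], where the [c_j]
    are the signs. A greedy choice of the signs replaces the probability
    ([greedy_signs], [tame_functional]).

    Flat functionals come from the choice of [B]. By duality, if there is none,
    every [y] in the cone spanned by the [w_j] is a sum [z + r], taken in the
    lattice of [B], where the norms of the blocks of [z] sum to at most [C |y|]
    and [|r| <= |y| / 2]; such a sequence [w] is called splitting. It is enough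
    to refine the basis so that no block sequence is splitting, for one [C] at a
    time ([nonsplitting_blocks]), and then to diagonalise over [C]. If this were
    impossible, splitting sequences could be nested: each remainder [r] is split
    again in a finer lattice, the remainders decrease geometrically, and the
    estimates add up to a lower l1 estimate with constant [2 C + 1]. Infinite l1
    sequences are excluded by reflexivity ([no_l1_reflexive]), so the tree of
    finite l1 sequences with rational entries is well-founded. The nesting goes
    from fine to coarse lattices, while the vectors are chosen in the coarsest
    one; induction over the well-founded tree, with a diagonal sequence over the
    countably many children of each node, reconciles the two orders. *)

(** * The Mazur-Orlicz theorem *)

Section MazurOrlicz.
Variables (R : realType) (E : lmodType R).

Definition sublinear (p : E -> R) : Prop :=
  (forall x y, p (x + y) <= p x + p y) /\
  (forall t x, 0 <= t -> p (t *: x) <= t * p x).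

Definition convex_cone (G : set (E * R)) : Prop :=
  [/\ G (0, 0),
      forall g h, G g -> G h -> G (g.1 + h.1, g.2 + h.2) &
      forall t g, 0 <= t -> G g -> G (t *: g.1, t * g.2)].

Lemma sublinear0 p : sublinear p -> p 0 = 0.
Proof.
move=> [pD pZ]; have := pZ 0 0 (lexx _); have := pD 0 0.
by rewrite scale0r addr0 mul0r => *; lra.
Qed.

Lemma sublinearN p x : sublinear p -> - p (- x) <= p x.
Proof.
by move=> sp; have := sp.1 x (- x); rewrite subrr (sublinear0 sp) => *; lra.
Qed.

(** The functional is the infimum of [p (x + g) - r] over the pairs [(g, r)] of
    the cone; the hypothesis [r <= p g] keeps it above [- p (- x)]. *)
Lemma sublinear_below_cone p G : sublinear p -> convex_cone G ->
  (forall g, G g -> g.2 <= p g.1) ->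
  exists q, [/\ sublinear q, forall x, q x <= p x &
                forall g, G g -> q (- g.1) <= - g.2].
Proof.
move=> sp [G0 GD GZ] Gp; have [pD pZ] := sp.
pose S x := [set p (x + g.1) - g.2 | g in G].
have lbS x : lbound (S x) (- p (- x)).
  move=> _ [g Gg <-]; have := Gp _ Gg; have := pD (x + g.1) (- x).
  by rewrite addrAC subrr add0r => *; lra.
have hS x : has_inf (S x).
  by split; [exists (p (x + 0) - 0); exists (0, 0) | exists (- p (- x))].
have qle x g : G g -> inf (S x) <= p (x + g.1) - g.2.
  by move=> Gg; apply: ge_inf; [exact: (hS x).2 | exists g].
exists (fun x => inf (S x)); split.
- split=> [x y|t x t0].
    apply/ler_addgt0Pr => eps eps0.
    have e2 : 0 < eps / 2 by lra.
    have [_ [g Gg <-] ltg] := inf_adherent e2 (hS x).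
    have [_ [h Gh <-] lth] := inf_adherent e2 (hS y).
    have := qle (x + y) _ (GD _ _ Gg Gh); rewrite /= addrACA.
    by have := pD (x + g.1) (y + h.1) => *; lra.
  have [->|tn0] := eqVneq t 0.
    rewrite scale0r mul0r; have := qle 0 _ G0.
    by rewrite /= addr0 (sublinear0 sp) subr0.
  have tgt0 : 0 < t by rewrite lt_neqAle eq_sym tn0.
  rewrite -ler_pdivrMl //; apply: lb_le_inf; first exact: (hS x).1.
  move=> _ [g Gg <-]; rewrite ler_pdivrMl //.
  have := qle (t *: x) _ (GZ _ _ t0 Gg); rewrite /= -scalerDr.
  by have := pZ t (x + g.1) t0 => *; lra.
- by move=> x; have := qle x _ G0; rewrite /= addr0 subr0.
- by move=> g /(qle (- g.1)); rewrite addNr (sublinear0 sp) sub0r.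
Qed.

(** Zorn: along a chain the pointwise infimum stays subadditive because any two
    members are bounded by the smaller of them. *)
Lemma minimal_sublinear p : sublinear p ->
  exists2 q, sublinear q /\ (forall x, q x <= p x) &
    forall q', sublinear q' -> (forall x, q' x <= q x) -> q' = q.
Proof.
move=> sp; pose T := {q : E -> R | sublinear q /\ forall x, q x <= p x}.
pose le (q q' : T) := `[< forall x, sval q' x <= sval q x >].
have := @Zorn T le; case.
- by move=> t; apply/asboolP.
- move=> r s t /asboolP rs /asboolP st; apply/asboolP => x.
  exact: le_trans (st x) (rs x).
- move=> [s s_sub] [t t_sub] /asboolP /= st /asboolP /= ts.
  by apply: eq_exist; apply/funext => x; apply/le_anti/andP; split.
- move=> A Atot.
  have [/set0P[q0 Aq0]|/negP] := boolP (A != set0); last first.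
    move/negP; rewrite negbK => /eqP ->.
    by exists (exist _ p (conj sp (fun x => lexx _))) => s.
  pose S x := [set sval q x | q in A].
  have lbS x : lbound (S x) (- p (- x)).
    move=> _ [[q [sq qp]] _ <-] /=.
    have := sublinearN x sq; have := qp (- x) => *; lra.
  have hS x : has_inf (S x).
    by split; [exists (sval q0 x); exists q0 | exists (- p (- x))].
  have Sle x q : A q -> inf (S x) <= sval q x.
    by move=> Aq; apply: ge_inf; [exact: (hS x).2 | exists q].
  have s_inf : sublinear (fun x => inf (S x)).
    split=> [x y|t x t0].
      apply/ler_addgt0Pr => eps eps0.
      have e2 : 0 < eps / 2 by lra.
      have [_ [g Ag <-] ltg] := inf_adherent e2 (hS x).
      have [_ [h Ah <-] lth] := inf_adherent e2 (hS y).
      have [/asboolP gh|/asboolP hg] := Atot _ _ Ag Ah.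
        have := Sle (x + y) _ Ah; have := (svalP h).1.1 x y.
        by have := gh x => *; lra.
      have := Sle (x + y) _ Ag; have := (svalP g).1.1 x y.
      by have := hg y => *; lra.
    have [->|tn0] := eqVneq t 0.
      rewrite scale0r mul0r; have := Sle 0 _ Aq0.
      by rewrite (sublinear0 (svalP q0).1).
    have tgt0 : 0 < t by rewrite lt_neqAle eq_sym tn0.
    rewrite -ler_pdivrMl //; apply: lb_le_inf; first exact: (hS x).1.
    move=> _ [g Ag <-]; rewrite ler_pdivrMl //.
    exact: le_trans (Sle _ _ Ag) ((svalP g).1.2 _ _ t0).
  have inf_p x : inf (S x) <= p x.
    exact: le_trans (Sle _ _ Aq0) ((svalP q0).2 x).
  exists (exist _ (fun x => inf (S x)) (conj s_inf inf_p)) => s As; apply/asboolP => x.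
  exact: Sle.
move=> [q [sq qp]] qmin; exists q => // q' sq' q'q.
have q'p x : q' x <= p x := le_trans (q'q x) (qp x).
have := qmin (exist _ q' (conj sq' q'p)) (asboolT q'q).
by move/(congr1 sval).
Qed.

(** A minimal sublinear functional is linear: lowering it along the ray of [a]
    by [sublinear_below_cone] cannot change it, which forces its value at [- a]
    to be the opposite of its value at [a]. *)
Theorem mazur_orlicz p G : sublinear p -> convex_cone G ->
  (forall g, G g -> g.2 <= p g.1) ->
  exists F : {linear E -> R^o},
    (forall x, (F x : R) <= p x) /\ (forall g, G g -> g.2 <= F g.1).
Proof.
move=> sp cG Gp.
have [p' [sp' p'p p'G]] := sublinear_below_cone sp cG Gp.
have [q [sq qp'] qmin] := minimal_sublinear sp'.
have [qD qZ] := sq.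
have qN a : q (- a) = - q a.
  pose Ga := [set g | exists2 t, 0 <= t & g = (t *: a, t * q a)].
  have cGa : convex_cone Ga.
    split; first by exists 0; rewrite // scale0r mul0r.
      move=> _ _ [t t0 ->] [s s0 ->]; exists (t + s); first by lra.
      by rewrite /= scalerDl mulrDl.
    move=> t _ t0 [s s0 ->]; exists (t * s); first exact: mulr_ge0.
    by rewrite /= scalerA mulrA.
  have qGa g : Ga g -> g.2 <= q g.1.
    move=> [t t0 ->] /=; have [->|tn0] := eqVneq t 0.
      by rewrite mul0r scale0r (sublinear0 sq).
    have tgt0 : 0 < t by rewrite lt_neqAle eq_sym tn0.
    rewrite -ler_pdivlMl //; have := qZ t^-1 (t *: a).
    by rewrite invr_ge0 scalerA mulVf // scale1r; apply.
  have [q' [sq' q'q q'G]] := sublinear_below_cone sq cGa qGa.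
  have := q'G (a, q a); rewrite (qmin _ sq' q'q) /= => qa.
  apply/le_anti/andP; split; last by have := sublinearN a sq; lra.
  by apply: qa; exists 1; rewrite // scale1r mul1r.
have qA x y : q (x + y) = q x + q y.
  apply/le_anti/andP; split; first exact: qD.
  have := qD (- x) (- y); rewrite -opprD !qN => *; lra.
have qL : linear (q : E -> R^o).
  suff qpos t x : 0 <= t -> q (t *: x) = t * q x.
    move=> t x y; rewrite qA; congr (_ + _).
    have [t0|t0] := leP 0 t; first exact: qpos.
    have := qpos (- t) x; rewrite scaleNr qN mulNr => qt.
    by apply: oppr_inj; rewrite qt // oppr_ge0 ltW.
  move=> t0; apply/le_anti/andP; split; first exact: qZ.
  by have := qZ t (- x) t0; rewrite scalerN !qN mulrN => *; lra.
pose qlin := GRing.isLinear.Build R E R^o *:%R q qL.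
pose F : {linear E -> R^o} := HB.pack q qlin.
exists F; split=> [x|g /p'G]; first exact: le_trans (qp' x) (p'p x).
have := qp' (- g.1); rewrite qN => h1 h2.
by change (g.2 <= q g.1); lra.
Qed.

End MazurOrlicz.

(** * Block sequences *)

Section BlockSequences.
Variables (R : realType).
Implicit Types (b v w : nat -> {poly R}) (p q : {poly R}).

Definition nonneg p : Prop := forall i, 0 <= p`_i.
Definition supported_from (m : nat) p : Prop := forall i, (i < m)%N -> p`_i = 0.

Definition cone b : set {poly R} :=
  [set y | exists n (a : nat -> R),
     (forall j, 0 <= a j) /\ y = \sum_(j < n) a j *: b j].

Definition block_seq b : Prop :=
  [/\ forall j, nonneg (b j), forall j, b j != 0 &
      forall j k i i', (j < k)%N -> (b j)`_i != 0 -> (b k)`_i' != 0 ->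
        (i < i')%N].

Definition blocks_of v w : Prop := forall j, cone w (v j).
Definition eventually_blocks_of v w : Prop :=
  exists m, forall j, (m <= j)%N -> cone w (v j).

Lemma cone_pad b y : cone b y -> exists n (a : nat -> R),
  (forall j, 0 <= a j) /\
  forall m, (n <= m)%N -> y = \sum_(j < m) a j *: b j.
Proof.
move=> [n [a [a0 ->]]]; exists n, (fun j => if (j < n)%N then a j else 0).
split=> [j|m nm]; first by case: ifP.
rewrite (big_ord_widen_cond m xpredT (fun j => a j *: b j) nm) big_mkcond /=.
by apply: eq_bigr => j _; case: ifP; rewrite // scale0r.
Qed.

Lemma cone0 b : cone b 0.
Proof. by exists 0%N, (fun=> 0); rewrite big_ord0. Qed.

Lemma cone_add b x y : cone b x -> cone b y -> cone b (x + y).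
Proof.
move=> /cone_pad[n [a [a0 xE]]] /cone_pad[m [c [c0 yE]]].
exists (maxn n m), (fun j => a j + c j); split=> [j|]; first exact: addr_ge0.
rewrite (xE _ (leq_maxl n m)) (yE _ (leq_maxr n m)) -big_split /=.
by apply: eq_bigr => j _; rewrite scalerDl.
Qed.

Lemma cone_scale b t y : 0 <= t -> cone b y -> cone b (t *: y).
Proof.
move=> t0 [n [a [a0 ->]]]; exists n, (fun j => t * a j).
split=> [j|]; first exact: mulr_ge0.
by rewrite scaler_sumr; apply: eq_bigr => j _; rewrite scalerA.
Qed.

Lemma cone_sum b n (f : nat -> {poly R}) :
  (forall j, (j < n)%N -> cone b (f j)) -> cone b (\sum_(j < n) f j).
Proof.
move=> bf; elim/big_ind: _ => [|x y|j _]; [exact: cone0|exact: cone_add|].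
exact: bf.
Qed.

Lemma cone_mem b j : cone b (b j).
Proof.
exists j.+1, (fun i => (i == j)%:R); split=> [i|]; first exact: ler0n.
rewrite big_ord_recr /= eqxx scale1r big1 ?add0r // => i _.
by rewrite ltn_eqF // scale0r.
Qed.

Lemma cone_trans v w y : blocks_of v w -> cone v y -> cone w y.
Proof.
move=> vw [n [a [a0 ->]]]; apply: (@cone_sum w n (fun j => a j *: v j)) => j _.
exact: cone_scale (a0 j) (vw j).
Qed.

Lemma blocks_trans u v w : blocks_of u v -> blocks_of v w -> blocks_of u w.
Proof. by move=> uv vw j; apply: cone_trans vw (uv j). Qed.

Lemma cone_nonneg b y : block_seq b -> cone b y -> nonneg y.
Proof.
move=> [b0 _ _] [n [a [a0 ->]]] i; rewrite coef_sum sumr_ge0 // => j _.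
by rewrite coefZ mulr_ge0 // b0.
Qed.

Lemma nonneg_lead p : nonneg p -> p != 0 -> 0 < p`_(size p).-1.
Proof. by move=> p0 pn0; rewrite lt_neqAle p0 eq_sym lead_coef_eq0 pn0. Qed.

Lemma block_seq_from b j : block_seq b -> supported_from j (b j).
Proof.
move=> [b0 bn0 bs]; elim: j => [//|j IH] i; rewrite ltnS => ij.
apply/eqP/negPn/negP => bi.
have := bs j j.+1 _ _ (ltnSn j) (lt0r_neq0 (nonneg_lead (b0 j) (bn0 j))) bi.
move=> /leq_trans /(_ ij) lt_j.
by have := nonneg_lead (b0 j) (bn0 j); rewrite (IH _ lt_j) ltxx.
Qed.

(** The first finitely many vectors of [v] sit at the left of some [M]; a
    combination of the [v j] starting after [M] cannot use them, because
    nothing cancels in a cone of nonnegative vectors. *)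
Lemma eventually_blocks_cone v w : block_seq v -> eventually_blocks_of v w ->
  exists M, forall y, cone v y -> supported_from M y -> cone w y.
Proof.
move=> bv [m mw]; have [v0 vn0 _] := bv.
exists (\max_(j < m) size (v j)) => y [n [a [a0 yE]]] yM.
rewrite yE; apply: (@cone_sum w n (fun j => a j *: v j)) => j jn.
have [mj|jm] := leqP m j; first exact: cone_scale (a0 j) (mw j mj).
suff -> : a j = 0 by rewrite scale0r; exact: cone0.
have lead_j := nonneg_lead (v0 j) (vn0 j).
have lead_lt : ((size (v j)).-1 < \max_(j < m) size (v j))%N.
  apply: leq_trans (leq_bigmax (Ordinal jm)) => /=.
  by rewrite prednK // lt0n size_poly_eq0 vn0.
have := yM _ lead_lt; rewrite yE coef_sum => /psumr_eq0P sum0.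
have /= := sum0 _ (Ordinal jn) isT.
rewrite coefZ => /(_ _)/eqP; rewrite mulf_eq0 (gt_eqF lead_j) orbF.
by move=> aj; apply/eqP/aj => i _; rewrite coefZ mulr_ge0 // v0.
Qed.

Lemma blocks_eventually v w : blocks_of v w -> eventually_blocks_of v w.
Proof. by move=> vw; exists 0%N => j _; exact: vw. Qed.

Lemma eventually_blocks_trans u v w : block_seq u -> block_seq v ->
  eventually_blocks_of u v -> eventually_blocks_of v w ->
  eventually_blocks_of u w.
Proof.
move=> bu bv [m uv] /(eventually_blocks_cone bv)[M Mw].
exists (maxn m M) => j; rewrite geq_max => /andP[mj Mj].
apply: Mw (uv j mj) _ => i iM; apply: (block_seq_from bu).
exact: leq_trans iM Mj.
Qed.

(** The [n]-th vector is taken from the [n]-th refinement, far enough to the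
    right of its predecessor; from index [n] on the diagonal sequence is then
    built from the [n]-th refinement. *)
Lemma diagonal_blocks (b0 : nat -> {poly R})
    (P : nat -> (nat -> {poly R}) -> Prop) :
  (forall n v w, block_seq v -> block_seq w -> eventually_blocks_of v w ->
     P n w -> P n v) ->
  (forall n w, block_seq w -> blocks_of w b0 ->
     exists v, [/\ block_seq v, blocks_of v w & P n v]) ->
  forall w, block_seq w -> blocks_of w b0 ->
    exists v, [/\ block_seq v, blocks_of v w & forall n, P n v].
Proof.
move=> hered dense w bw wb0.
have /choice[f fP] : forall nw : nat * (nat -> {poly R}), exists v,
    block_seq nw.2 -> blocks_of nw.2 b0 ->
    [/\ block_seq v, blocks_of v nw.2 & P nw.1 v].
  move=> [n w'] /=; have [[bw' wb']|nb] :=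
    pselect (block_seq w' /\ blocks_of w' b0).
    by have [v vP] := dense n w' bw' wb'; exists v.
  by exists w' => bw' wb'; case: nb.
pose W := fix W n := if n is n'.+1 then f (n', W n') else w.
have WP n : block_seq (W n) /\ blocks_of (W n) b0.
  elim: n => [//|n [bn nb0]]; have [? ? _] := fP (n, W n) bn nb0.
  by split=> //; apply: blocks_trans nb0.
have fW n : blocks_of (W n.+1) (W n) /\ P n (W n.+1).
  by have [bn nb0] := WP n; have [_ ? ?] := fP (n, W n) bn nb0.
have Wle n m : (n <= m)%N -> blocks_of (W m) (W n).
  elim: m => [|m IH]; first by rewrite leqn0 => /eqP -> j; exact: cone_mem.
  rewrite leq_eqVlt => /predU1P[->|nm]; first by move=> j; exact: cone_mem.
  exact: blocks_trans (fW m).1 (IH nm).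
pose v := fix v n := if n is n'.+1 then W n (size (v n')) else w 0%N.
have vW n : exists j, v n = W n j.
  by case: n => [|n]; [exists 0%N | exists (size (v n))].
have v0 n : nonneg (v n).
  by have [j ->] := vW n; have [[]] := WP n.
have vn0 n : v n != 0.
  by have [j ->] := vW n; have [[]] := WP n.
have vfrom n : supported_from (size (v n)) (v n.+1).
  exact: block_seq_from (WP n.+1).1.
have vsize n : (size (v n) <= size (v n.+1))%N.
  have := nonneg_lead (v0 n.+1) (vn0 n.+1).
  case: leqP => // lt_size; rewrite vfrom ?ltxx //.
  by rewrite (leq_ltn_trans (leq_pred _)).
have vsize_le j k : (j <= k)%N -> (size (v j) <= size (v k))%N.
  elim: k => [|k IH]; first by rewrite leqn0 => /eqP ->.
  by rewrite leq_eqVlt => /predU1P[->//|/IH /leq_trans]; apply.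
have bv : block_seq v.
  split=> // j [//|k] i i'; rewrite ltnS => jk vi vi'.
  have lt_i : (i < size (v j))%N.
    by rewrite ltnNge; apply: contra vi => /leq_sizeP ->.
  apply: leq_trans lt_i _; apply: leq_trans (vsize_le _ _ jk) _.
  by rewrite leqNgt; apply: contra vi' => /vfrom ->.
have vWn n : eventually_blocks_of v (W n).
  exists n => j nj; apply: cone_trans (Wle _ _ nj) _.
  by have [i ->] := vW j; exact: cone_mem.
exists v; split=> // [j|n].
  apply: cone_trans (Wle _ _ (leq0n j)) _.
  by have [i ->] := vW j; exact: cone_mem.
exact: hered bv (WP n.+1).1 (vWn n.+1) (fW n).2.
Qed.

End BlockSequences.

(** * Refining away splitting sequences *)

Section LatticeNorm.
Variables (R : realType) (N : {poly R} -> R).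

Definition lattice_norm : Prop :=
  [/\ forall p q, N (p + q) <= N p + N q,
      forall t p, N (t *: p) = `|t| * N p,
      forall p q : {poly R}, (forall i, `|p`_i| <= `|q`_i|) -> N p <= N q &
      forall p, N p = 0 -> p = 0].

Hypothesis latN : lattice_norm.

Lemma latN0 : N 0 = 0.
Proof. by have [_ NZ _ _] := latN; rewrite -(scale0r 0) NZ normr0 mul0r. Qed.

Lemma latNN p : N (- p) = N p.
Proof. by have [_ NZ _ _] := latN; rewrite -scaleN1r NZ normrN1 mul1r. Qed.

Lemma latN_ge0 p : 0 <= N p.
Proof.
have [ND _ _ _] := latN; have := ND p (- p).
by rewrite subrr latN0 latNN => *; lra.
Qed.

Lemma latN_gt0 p : p != 0 -> 0 < N p.
Proof.
have [_ _ _ Ninj] := latN => pn0; rewrite lt_neqAle latN_ge0 andbT eq_sym.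
by apply: contra pn0 => /eqP/Ninj ->.
Qed.

Lemma latN_sum (I : Type) (s : seq I) (P : pred I) (f : I -> {poly R}) :
  N (\sum_(i <- s | P i) f i) <= \sum_(i <- s | P i) N (f i).
Proof.
have [ND _ _ _] := latN.
apply: (big_ind2 (fun x y => N x <= y)); first by rewrite latN0.
  by move=> x1 y1 x2 y2 h1 h2; apply: le_trans (ND _ _) _; exact: lerD.
by [].
Qed.

Lemma latN_mono p q : nonneg p -> nonneg (q - p) -> N p <= N q.
Proof.
have [_ _ Nmono _] := latN => p0 pq; apply: Nmono => i.
have := pq i; rewrite coefB subr_ge0 => le_pq.
by rewrite !ger0_norm // (le_trans (p0 i)).
Qed.

(** Rational vectors are what keeps the tree of l1 sequences countable. Zero
    entries are approximated by zero, so that supports do not spread to the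
    left. *)
Lemma rat_approximation (p : {poly R}) (eta : R) : 0 < eta ->
  exists2 c : {poly rat}, forall m, supported_from m p ->
      supported_from m (map_poly ratr c : {poly R}) &
    N (p - map_poly ratr c) <= eta.
Proof.
move=> eta0; have [_ NZ _ _] := latN.
have den_gt0 i : 0 < (size p).+1%:R * (N 'X^i + 1).
  by rewrite mulr_gt0 ?ltr0n // ltr_wpDl ?latN_ge0.
have /choice[c cP] : forall i, exists c : rat, (p`_i = 0 -> c = 0) /\
    `|p`_i - ratr c| * N 'X^i <= eta / (size p).+1%:R.
  move=> i; have [p0|pn0] := eqVneq p`_i 0.
    exists 0; rewrite p0 raddf0 subr0 normr0 mul0r; split=> //.
    by rewrite divr_ge0 // ltW.
  pose e := eta / ((size p).+1%:R * (N 'X^i + 1)).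
  have e0 : 0 < e by rewrite divr_gt0.
  have [c] := @rat_in_itvoo R (p`_i - e) (p`_i + e) ltac:(lra).
  rewrite in_itv /= => /andP[cl cr]; exists c; split=> [p0|].
    by rewrite p0 eqxx in pn0.
  have ce : `|p`_i - ratr c| <= e by rewrite ler_norml; apply/andP; split; lra.
  apply: (@le_trans _ _ (e * (N 'X^i + 1))).
    by apply: ler_pM => //; [exact: latN_ge0 | rewrite lerDl].
  rewrite /e invfM mulrA -mulrA mulVf ?mulr1 //.
  by rewrite gt_eqF // ltr_wpDl ?latN_ge0.
exists (\poly_(i < size p) c i).
  move=> m pm i im; rewrite coef_map coef_poly; case: ifP; rewrite ?raddf0 //.
  by rewrite (cP i).1 ?raddf0 // pm.
have -> : p - map_poly ratr (\poly_(i < size p) c i) =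
    \sum_(i < size p) (p`_i - ratr (c i)) *: 'X^i.
  apply/polyP => j; rewrite coefB coef_map coef_poly.
  rewrite -(poly_def (size p) (fun i => p`_i - ratr (c i))) coef_poly.
  by case: ltnP => // jp; rewrite raddf0 subr0 nth_default.
apply: le_trans (latN_sum _ _ _) _.
apply: (@le_trans _ _ (\sum_(i < size p) eta / (size p).+1%:R)).
  by apply: ler_sum => i _; rewrite NZ; exact: (cP i).2.
rewrite sumr_const card_ord -[_ *+ size p]mulr_natr -mulrA ger_pMr //.
rewrite mulrC ler_pdivrMr ?ltr0n // mul1r ler_nat; exact: leqnSn.
Qed.

(** The removed parts [u k - u' k] satisfy an l1 estimate and the remainder is
    halved. The remainder lies in the cone of [b], so it can be split once more
    if [b] is eventually built from a splitting sequence of a finer cone. *)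
Definition splitting (C : R) (w b : nat -> {poly R}) : Prop :=
  forall r (u : nat -> {poly R}), (forall k, (k < r)%N -> cone w (u k)) ->
  exists u', [/\ forall k, (k < r)%N -> cone b (u' k) /\ nonneg (u k - u' k),
    \sum_(k < r) N (u k - u' k) <= C * N (\sum_(k < r) u k) &
    N (\sum_(k < r) u' k) <= 1 / 2 * N (\sum_(k < r) u k)].

Definition no_l1 : Prop := forall (x : nat -> {poly R}) (D : R),
  (forall l, supported_from l (x l)) -> (forall l, N (x l) <= 2) ->
  ~ forall n (t : nat -> R), (forall l, 0 <= t l) ->
      \sum_(l < n) t l <= D * N (\sum_(l < n) t l *: x l).

Section Refinement.
Hypothesis noL1 : no_l1.
Variables (C : R) (b0 : nat -> {poly R}).
Hypothesis C0 : 0 <= C.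
Hypothesis bb0 : block_seq b0.
Hypothesis always_splitting : forall b, block_seq b -> blocks_of b b0 ->
  exists w, [/\ block_seq w, blocks_of w b & splitting C w b].

Let K : R := 2 * C + 1.
Let K_gt0 : 0 < K. Proof. by rewrite /K; move: C0 => *; lra. Qed.

Let vec (c : {poly rat}) : {poly R} := map_poly ratr c.

(** The constant is [2 * K] because the vectors for which the estimate is known
    with constant [K] are replaced by rational ones at distance [(2 * K)^-1]. *)
Definition l1_node (s : seq {poly rat}) : Prop :=
  (forall l, (l < size s)%N ->
     supported_from l (vec s`_l) /\ N (vec s`_l) <= 2) /\
  forall t : nat -> R, (forall l, 0 <= t l) ->
    \sum_(l < size s) t l <= 2 * K * N (\sum_(l < size s) t l *: vec s`_l).

(** The state of the l1 estimate after several splittings: the vectors [ys] are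
    fixed, the family [u] stands for all later choices, and [u'] is what the
    splittings have left of it in the cone of [v]. The third term on the left is
    the reserve for further splittings: one of them spends
    [(C + 1 / 2) * N (\sum u')] and halves the remainder, and [K = 2 * C + 1]
    balances the two. *)
Definition absorbs (w0 : nat -> {poly R}) (ys : seq {poly R})
    (v : nat -> {poly R}) : Prop :=
  exists m, forall t : nat -> R, (forall l, 0 <= t l) ->
  forall r (u : nat -> {poly R}),
  (forall k, (k < r)%N -> cone w0 (u k) /\ supported_from m (u k)) ->
  exists u', (forall k, (k < r)%N -> cone v (u' k) /\ nonneg (u k - u' k)) /\
    \sum_(l < size ys) t l * N ys`_l + \sum_(k < r) N (u k - u' k)
      + K * N (\sum_(k < r) u' k)
    <= K * N (\sum_(l < size ys) t l *: ys`_l + \sum_(k < r) u k).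

(** Stated negatively, since the induction over the tree has to show that no
    sequence can be absorbed; in this form the property passes to refinements
    and can be diagonalised over the children of a node. *)
Definition avoids (s : seq {poly rat}) (v : nat -> {poly R}) : Prop :=
  forall w0 ys, block_seq w0 -> eventually_blocks_of w0 v ->
    size ys = size s ->
    (forall l, (l < size s)%N ->
       N ys`_l = 1 /\ N (ys`_l - vec s`_l) <= (2 * K)^-1) ->
    ~ absorbs w0 ys v.

Definition avoidable (s : seq {poly rat}) : Prop :=
  forall b, block_seq b -> blocks_of b b0 ->
    exists v, [/\ block_seq v, blocks_of v b & avoids s v].

Lemma absorbs_coarser w0 ys v w : block_seq v -> eventually_blocks_of v w ->
  absorbs w0 ys v -> absorbs w0 ys w.
Proof.
move=> bv /(eventually_blocks_cone bv)[M Mw] [m mP].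
exists (maxn m M) => t t0 r u uP.
have [|u' [u'P le_u']] := mP t t0 r u.
  move=> k kr; have [uk ufrom] := uP k kr; split=> // i im.
  by apply: ufrom; rewrite leq_max im.
exists u'; split=> // k kr; have [vu' uu'] := u'P k kr; split=> //.
apply: Mw => // i iM; apply/le_anti/andP; split; last first.
  exact: (cone_nonneg bv vu').
have := uu' i; rewrite coefB (uP k kr).2 ?sub0r ?oppr_ge0 //.
by rewrite leq_max iM orbT.
Qed.

Lemma avoids_hereditary s v w : block_seq v -> block_seq w ->
  eventually_blocks_of v w -> avoids s w -> avoids s v.
Proof.
move=> bv bw vw sw w0 ys bw0 w0v sz ysP abs.
apply: (sw w0 ys) => //; first exact: eventually_blocks_trans w0v vw.
exact: absorbs_coarser abs.
Qed.

(** The new vector [y] becomes the first member of a longer family; its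
    remainders are then split once more, in the cone of [v]. *)
Lemma absorbs_rcons w0 ys y w v :
  block_seq w -> block_seq v -> splitting C w v -> N y = 1 ->
  forall m, cone w0 y -> supported_from m y ->
  (forall t : nat -> R, (forall l, 0 <= t l) ->
  forall r (u : nat -> {poly R}),
  (forall k, (k < r)%N -> cone w0 (u k) /\ supported_from m (u k)) ->
  exists u', (forall k, (k < r)%N -> cone w (u' k) /\ nonneg (u k - u' k)) /\
    \sum_(l < size ys) t l * N ys`_l + \sum_(k < r) N (u k - u' k)
      + K * N (\sum_(k < r) u' k)
    <= K * N (\sum_(l < size ys) t l *: ys`_l + \sum_(k < r) u k)) ->
  absorbs w0 (rcons ys y) v.
Proof.
have [ND NZ _ _] := latN.
move=> bw bv wv Ny m w0y ym inv; exists m => t t0 r u uP.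
pose U k := if k is k'.+1 then u k' else t (size ys) *: y.
have UP k : (k < r.+1)%N -> cone w0 (U k) /\ supported_from m (U k).
  case: k => [_|k]; last exact: uP.
  by split=> [|i im]; [exact: cone_scale | rewrite /U coefZ ym ?mulr0].
have [u1 [u1P le1]] := inv t t0 _ _ UP.
have [u2 [u2P le2 half]] := wv _ _ (fun k kr => (u1P k kr).1).
have u2_ge0 k : (k < r.+1)%N -> nonneg (u2 k).
  by move=> kr; exact: cone_nonneg (u2P k kr).1.
exists (fun k => u2 k.+1); split=> [k kr|].
  split=> [|i]; first exact: (u2P k.+1 kr).1.
  have := (u1P k.+1 kr).2 i; have := (u2P k.+1 kr).2 i.
  by rewrite /U !coefB => *; lra.
rewrite size_rcons !big_ord_recr /= nth_rcons ltnn eqxx Ny mulr1.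
under eq_bigr do rewrite nth_rcons ltn_ord.
under [in X in _ <= X]eq_bigr do rewrite nth_rcons ltn_ord.
have tail_nonneg : nonneg (\sum_(k < r) u2 k.+1).
  move=> i; rewrite coef_sum sumr_ge0 // => k _; apply: u2_ge0.
  by rewrite ltnS ltn_ord.
have head_le : N (u2 0%N) <= N (\sum_(k < r.+1) u2 k).
  apply: latN_mono; first exact: u2_ge0.
  by rewrite big_ord_recl addrAC subrr add0r.
have tail_le : N (\sum_(k < r) u2 k.+1) <= N (\sum_(k < r.+1) u2 k).
  apply: latN_mono => //; rewrite big_ord_recl addrK.
  exact: u2_ge0.
have ty_le : t (size ys) <=
    N (U 0%N - u1 0%N) + N (u1 0%N - u2 0%N) + N (u2 0%N).
  have -> : t (size ys) = N (U 0%N) by rewrite NZ Ny mulr1 ger0_norm.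
  have := ND (U 0%N - u1 0%N) (u1 0%N); rewrite subrK.
  by have := ND (u1 0%N - u2 0%N) (u2 0%N); rewrite subrK => *; lra.
have u_le : \sum_(k < r) N (u k - u2 k.+1) <=
    \sum_(k < r) N (U k.+1 - u1 k.+1) + \sum_(k < r) N (u1 k.+1 - u2 k.+1).
  rewrite -big_split; apply: ler_sum => k _ /=.
  by apply: le_trans (ND _ _); rewrite addrA subrK.
have K_half : K / 2 * N (\sum_(k < r.+1) u1 k) =
    (C + 1 / 2) * N (\sum_(k < r.+1) u1 k) by congr (_ * _); rewrite /K; lra.
have Ktail : K * N (\sum_(k < r) u2 k.+1) <=
    K / 2 * N (\sum_(k < r.+1) u1 k).
  by rewrite -mulrA; apply: ler_wpM2l; [exact: ltW | lra].
have sumU : \sum_(k < r.+1) U k = t (size ys) *: y + \sum_(k < r) u k.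
  by rewrite big_ord_recl.
have sum1 : \sum_(k < r.+1) N (U k - u1 k) =
    N (U 0%N - u1 0%N) + \sum_(k < r) N (U k.+1 - u1 k.+1).
  by rewrite big_ord_recl.
have sum2 : \sum_(k < r.+1) N (u1 k - u2 k) =
    N (u1 0%N - u2 0%N) + \sum_(k < r) N (u1 k.+1 - u2 k.+1).
  by rewrite big_ord_recl.
rewrite sumU addrA sum1 in le1; rewrite sum2 in le2.
have KS : K * N (\sum_(k < r.+1) u1 k) =
  2 * (K / 2 * N (\sum_(k < r.+1) u1 k)) by lra.
lra.
Qed.

(** Let [v] avoid all children of [s] and let [w] split in [v]. If something
    near [s] were absorbed by [w], a further vector chosen far to the right and
    rounded to [c] would be absorbed by [v]. The estimate for the empty family
    says that [rcons s c] is a node, which contradicts the choice of [v]. *)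
Lemma avoidable_node s : l1_node s ->
  (forall c, l1_node (rcons s c) -> avoidable (rcons s c)) -> avoidable s.
Proof.
have [ND NZ Nmono _] := latN.
move=> [s_codes s_l1] child b bb bb0'.
pose P n v := forall c, choice.pickle c = n -> l1_node (rcons s c) ->
  avoids (rcons s c) v.
have [| |v [bv vb vP]] := @diagonal_blocks R b0 P _ _ b bb bb0'.
- move=> n v w bv bw vw Pw c cn sc.
  exact: avoids_hereditary vw (Pw c cn sc).
- move=> n w bw wb0.
  have [[c [cn sc]]|none] := pselect (exists c, choice.pickle c = n /\
      l1_node (rcons s c)).
    have [v [bv vw av]] := child c sc w bw wb0; exists v; split=> // c' c'n.
    by rewrite -c'n in cn; rewrite -(pcan_inj choice.pickleK cn).
  exists w; split=> //; first by move=> j; exact: cone_mem.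
  by move=> c cn sc; case: none; exists c.
have [w [bw wv splitwv]] := always_splitting bv (blocks_trans vb bb0').
exists w; split=> //; first exact: blocks_trans vb.
move=> w0 ys bw0 w0w sz ysP [m inv].
(* The index [j] puts [y] beyond [m], as [inv] requires, and beyond the length
   of [s], as nodes require. *)
pose j := maxn m (size s); pose y := (N (w0 j))^-1 *: w0 j.
have Nw0 : 0 < N (w0 j) by apply: latN_gt0; have [] := bw0.
have Ny : N y = 1.
  by rewrite NZ gtr0_norm ?invr_gt0 // mulVf // gt_eqF.
have w0y : cone w0 y.
  by apply: cone_scale; [rewrite invr_ge0 ltW | exact: cone_mem].
have yj : supported_from j y.
  by move=> i ij; rewrite coefZ (block_seq_from bw0) ?mulr0.
have ym : supported_from m y.
  by move=> i im; apply: yj; rewrite leq_max im.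
have K2 : 0 < (2 * K)^-1 by rewrite invr_gt0; move: K_gt0 => *; lra.
have K2_le1 : (2 * K)^-1 <= 1.
  by rewrite invf_le1; rewrite /K; move: C0 => *; lra.
have [c c_from c_near] := rat_approximation y K2.
have inv' := absorbs_rcons bw bv splitwv Ny w0y ym inv.
have nthP l : (l < (size s).+1)%N ->
    N (rcons ys y)`_l = 1 /\
    N ((rcons ys y)`_l - vec (rcons s c)`_l) <= (2 * K)^-1.
  rewrite ltnS leq_eqVlt => /predU1P[->|ls].
    by rewrite !nth_rcons sz ltnn eqxx.
  by rewrite !nth_rcons sz ls; exact: ysP.
apply: (vP (choice.pickle c) c erefl _ w0 (rcons ys y)) => //; last 3 first.
- exact: eventually_blocks_trans w0w (blocks_eventually wv).
- by rewrite !size_rcons sz.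
- by move=> l; rewrite size_rcons; exact: nthP.
split.
  move=> l; rewrite size_rcons ltnS leq_eqVlt => /predU1P[->|ls].
    rewrite nth_rcons ltnn eqxx; split.
      by apply: c_from => i ij; apply: yj; rewrite leq_max ij orbT.
    have := ND y (- (y - vec c)); rewrite latNN Ny subKr.
    by move: c_near K2_le1; rewrite /vec => *; lra.
  by rewrite nth_rcons ls; exact: s_codes.
move=> t t0; have [m' inv0] := inv'.
have [|u' [_]] := inv0 t t0 0%N (fun=> 0); first by [].
rewrite !big_ord0 latN0 mulr0 !addr0 !size_rcons sz => est.
have sumE : \sum_(l < (size s).+1) t l * N (rcons ys y)`_l =
    \sum_(l < (size s).+1) t l.
  by apply: eq_bigr => l _; rewrite (nthP l (ltn_ord l)).1 mulr1.
rewrite sumE in est.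
have diff : N (\sum_(l < (size s).+1) t l *: (rcons ys y)`_l) <=
    N (\sum_(l < (size s).+1) t l *: vec (rcons s c)`_l) +
    (2 * K)^-1 * \sum_(l < (size s).+1) t l.
  rewrite -[X in N X <= _](subrK
    (\sum_(l < (size s).+1) t l *: vec (rcons s c)`_l)) addrC.
  apply: le_trans (ND _ _) _; rewrite lerD2l -sumrB.
  apply: le_trans (latN_sum _ _ _) _; rewrite mulr_sumr; apply: ler_sum => l _.
  rewrite -scalerBr NZ ger0_norm // mulrC ler_wpM2r //.
  exact: (nthP l (ltn_ord l)).2.
have := ler_wpM2l (ltW K_gt0) diff.
have half : K * ((2 * K)^-1 * \sum_(l < (size s).+1) t l) =
    1 / 2 * \sum_(l < (size s).+1) t l.
  by rewrite mulrA invfM mulrCA mulfV ?gt_eqF // mulr1 div1r.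
by rewrite mulrDr half -mulrA => *; lra.
Qed.

(** A node that is not avoidable has a child that is not, and [no_l1] excludes
    the resulting infinite branch. On the other hand the empty sequence is not
    avoidable, as every [v] absorbs it. *)
Lemma refinement_contradiction : False.
Proof.
have node0 : l1_node [::].
  split=> // t t0; rewrite !big_ord0 latN0 mulr0; exact: lexx.
have av0 : avoidable [::].
  apply: contrapT => nav.
  have /choice[f fP] : forall s, exists c, l1_node s -> ~ avoidable s ->
      l1_node (rcons s c) /\ ~ avoidable (rcons s c).
    move=> s; have [[ns nav_s]|nn] := pselect (l1_node s /\ ~ avoidable s).
      have [[c cP]|none] := pselect (exists c, l1_node (rcons s c) /\
          ~ avoidable (rcons s c)); first by exists c.
      case: nav_s; apply: avoidable_node => // c sc.
      by apply: contrapT => nc; case: none; exists c.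
    by exists 0 => ns nav_s; case: nn.
  pose S := fix S n := if n is n'.+1 then rcons (S n') (f (S n')) else [::].
  have SP n : l1_node (S n) /\ ~ avoidable (S n).
    by elim: n => [//|n [? ?]]; exact: fP.
  pose c n := f (S n).
  have Sc n : S n = mkseq c n by elim: n => // n IH; rewrite mkseqS -IH.
  have cP n : supported_from n (vec (c n)) /\ N (vec (c n)) <= 2.
    have [[codes _] _] := SP n.+1; have := codes n.
    by rewrite Sc size_mkseq nth_mkseq //; apply.
  apply: (@noL1 (fun l => vec (c l)) (2 * K)) => [l|l|n t t0].
  - exact: (cP l).1.
  - exact: (cP l).2.
  have [[_ est] _] := SP n; have := est t t0; rewrite Sc size_mkseq.
  have -> : \sum_(l < n) t l *: vec (mkseq c n)`_l =
      \sum_(l < n) t l *: vec (c l) by apply: eq_bigr => l _; rewrite nth_mkseq.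
  by [].
have [v [bv _ av]] := av0 b0 bb0 (fun j => cone_mem b0 j).
apply: (av v [::]) => //; first by exists 0%N => j _; exact: cone_mem.
exists 0%N => t t0 r u uP; exists u; split=> [k kr|].
  by split=> [|i]; [exact: (uP k kr).1 | rewrite subrr coef0].
rewrite !big_ord0 !add0r big1 ?add0r // => k _.
by rewrite subrr latN0.
Qed.

End Refinement.

Theorem nonsplitting_blocks (C : R) b0 : no_l1 -> 0 <= C -> block_seq b0 ->
  exists b, [/\ block_seq b, blocks_of b b0 &
    forall w, block_seq w -> blocks_of w b -> ~ splitting C w b].
Proof.
move=> noL1 C0 bb0; apply: contrapT => none.
apply: (refinement_contradiction noL1 C0 bb0) => b bb bb0'.
apply: contrapT => nosplit; apply: none; exists b; split=> // w bw wb ws.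
by apply: nosplit; exists w.
Qed.

End LatticeNorm.

(** * Coordinates with respect to a block sequence *)

Section Combination.
Variables (R : realType) (E : lmodType R).
Implicit Types (e : nat -> E) (p : {poly R}).

Definition comb e p : E := \sum_(i < size p) p`_i *: e i.

Lemma comb_widen e p n : (size p <= n)%N -> comb e p = \sum_(i < n) p`_i *: e i.
Proof.
move=> pn; rewrite /comb (big_ord_widen n (fun i => p`_i *: e i) pn).
rewrite big_mkcond /=; apply: eq_bigr => i _; case: ltnP => // pi.
by rewrite nth_default ?scale0r.
Qed.

Lemma comb_is_linear e : linear (comb e).
Proof.
move=> t p q; pose n := maxn (size (t *: p + q)) (maxn (size p) (size q)).
rewrite !(@comb_widen e _ n) ?leq_maxl //; last 2 first.
- by rewrite /n !leq_max leqnn !orbT.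
- by rewrite /n !leq_max leqnn !orbT.
rewrite scaler_sumr -big_split; apply: eq_bigr => i _ /=.
by rewrite coefD coefZ scalerDl scalerA.
Qed.

HB.instance Definition _ e :=
  GRing.isLinear.Build R {poly R} E *:%R (comb e) (comb_is_linear e).

Lemma combXn e i : comb e 'X^i = e i.
Proof.
rewrite /comb size_polyXn big_ord_recr /= coefXn eqxx scale1r big1 ?add0r //.
by move=> j _; rewrite coefXn ltn_eqF // scale0r.
Qed.

End Combination.

Lemma poly_comb (R : realType) (p : {poly R}) : p = comb (fun i => 'X^i) p.
Proof.
rewrite /comb -poly_def; apply/polyP => i; rewrite coef_poly.
by case: ltnP => // /leq_sizeP ->.
Qed.

Lemma linear_comb (R : realType) (E F : lmodType R) (f : {linear E -> F})
    (e : nat -> E) (p : {poly R}) : f (comb e p) = comb (fun i => f (e i)) p.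
Proof.
by rewrite /comb linear_sum; apply: eq_bigr => i _; rewrite linearZ.
Qed.

(** The same property in the coordinates of a block basis, where the cone is the
    set of all nonnegative vectors, and for the vectors [a j *: w j] only. *)
Definition indexed_splitting (R : realType) (M : {poly R} -> R) (C : R)
    (w : nat -> {poly R}) : Prop :=
  forall n (a : nat -> R), (forall j, 0 <= a j) ->
  exists z : nat -> {poly R},
    [/\ forall j, (j < n)%N -> nonneg (z j) /\ nonneg (a j *: w j - z j),
        \sum_(j < n) M (z j) <= C * M (\sum_(j < n) a j *: w j) &
        M (\sum_(j < n) (a j *: w j - z j)) <=
          1 / 2 * M (\sum_(j < n) a j *: w j)].

Section BlockCoordinates.
Variables (R : realType) (N : {poly R} -> R) (b : nat -> {poly R}).
Hypotheses (latN : lattice_norm N) (bb : block_seq b).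

Lemma coef_comb_block p i m : (b i)`_m != 0 ->
  (comb b p)`_m = p`_i * (b i)`_m.
Proof.
move=> bim; have [_ _ bs] := bb.
rewrite (@comb_widen _ _ b p (maxn (size p) i.+1)) ?leq_maxl // coef_sum.
have lt_i : (i < maxn (size p) i.+1)%N by rewrite leq_max leqnn orbT.
rewrite (bigD1 (Ordinal lt_i)) //= coefZ big1 ?addr0 // => j /eqP nj.
have nji : nat_of_ord j != i by apply/eqP => ji; apply: nj; apply: val_inj.
rewrite coefZ; apply/eqP; rewrite mulf_eq0; apply/orP; right.
apply/negPn/negP => bjm; move: nji; rewrite neq_ltn => /orP[ji|ij].
  by have := bs _ _ _ _ ji bjm bim; rewrite ltnn.
by have := bs _ _ _ _ ij bim bjm; rewrite ltnn.
Qed.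

Lemma coef_comb_gap p m : (forall i, (b i)`_m = 0) -> (comb b p)`_m = 0.
Proof. by move=> bm; rewrite coef_sum big1 // => i _; rewrite coefZ bm mulr0. Qed.

Lemma comb_nonneg p : nonneg p -> nonneg (comb b p).
Proof.
have [b0 _ _] := bb => p0 m; rewrite coef_sum sumr_ge0 // => i _.
by rewrite coefZ mulr_ge0 // b0.
Qed.

Lemma cone_comb p : nonneg p -> cone b (comb b p).
Proof. by move=> p0; exists (size p), (fun i => p`_i). Qed.

Lemma lattice_norm_comb : lattice_norm (fun p => N (comb b p)).
Proof.
have [ND NZ Nmono Ninj] := latN; have [b0 bn0 _] := bb.
split=> [p q|t p|p q pq|p].
- by rewrite linearD; exact: ND.
- by rewrite linearZ; exact: NZ.
- apply: Nmono => m; have [[i bim]|none] := pselect (exists i, (b i)`_m != 0).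
    by rewrite !(coef_comb_block _ bim) !normrM ler_wpM2r.
  rewrite !coef_comb_gap // => i; apply/eqP/negPn/negP => bim.
    by apply: none; exists i.
  by apply: none; exists i.
- move=> /Ninj cp0; apply/polyP => i; rewrite coef0.
  have lead_i := lt0r_neq0 (nonneg_lead (b0 i) (bn0 i)).
  have := coef_comb_block p lead_i; rewrite cp0 coef0 => /esym/eqP.
  by rewrite mulf_eq0 (negPf lead_i) orbF => /eqP.
Qed.

Lemma block_seq_comb w : block_seq w -> block_seq (fun j => comb b (w j)).
Proof.
have [b0 bn0 bs] := bb; have [_ _ _ Ncinj] := lattice_norm_comb.
move=> [w0 wn0 ws]; split=> [j|j|j k m m' jk]; first exact: comb_nonneg.
  apply: contra (wn0 j) => /eqP cw0; apply/eqP/Ncinj.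
  by rewrite cw0; apply: latN0.
have hit p n : (comb b p)`_n != 0 -> exists i, p`_i != 0 /\ (b i)`_n != 0.
  move=> cn; have [[i bin]|none] := pselect (exists i, (b i)`_n != 0).
    exists i; split=> //; apply: contra cn => /eqP p0.
    by rewrite (coef_comb_block _ bin) p0 mul0r.
  suff c0 : (comb b p)`_n = 0 by rewrite c0 eqxx in cn.
  apply: coef_comb_gap => i; apply/eqP/negPn/negP => bin.
  by apply: none; exists i.
move=> /hit[i [wi bi]] /hit[i' [wi' bi']].
exact: bs (ws _ _ _ _ jk wi wi') bi bi'.
Qed.

(** The parts [z j] are distributed over the members of the family in proportion
    to their coefficients at [w j]. *)
Lemma splitting_of_indexed C w : block_seq w ->
  indexed_splitting (fun p => N (comb b p)) C w ->
  splitting N C (fun j => comb b (w j)) b.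
Proof.
have [ND NZ Nmono _] := latN.
move=> [w0 _ _] split_w r u uP.
have /choice[na naP] : forall k, exists na : nat * (nat -> R), (k < r)%N ->
    (forall j, 0 <= na.2 j) /\ forall m, (na.1 <= m)%N ->
    u k = \sum_(j < m) na.2 j *: comb b (w j).
  move=> k; have [kr|rk] := ltnP k r; last by exists (0%N, fun=> 0).
  by have /cone_pad[n [a aP]] := uP k kr; exists (n, a).
pose n := \max_(k < r) (na k).1; pose al k := (na k).2.
have al0 k j : (k < r)%N -> 0 <= al k j by move=> /naP[+ _]; apply.
have uE k : (k < r)%N -> u k = \sum_(j < n) al k j *: comb b (w j).
  move=> kr; have [_] := naP k kr; apply.
  exact: (@leq_bigmax _ (fun k : 'I_r => (na k).1) (Ordinal kr)).
pose a j := \sum_(k < r) al k j.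
have a0 j : 0 <= a j by apply: sumr_ge0 => k _; exact: al0.
have [z [zP le1 le2]] := split_w n a a0.
have sum_u : \sum_(k < r) u k = comb b (\sum_(j < n) a j *: w j).
  rewrite linear_sum /=.
  rewrite (eq_bigr (fun k : 'I_r => \sum_(j < n) al k j *: comb b (w j)));
    last by move=> k _; exact: uE.
  rewrite exchange_big /=; apply: eq_bigr => j _.
  by rewrite linearZ /= -scaler_suml.
pose be k j := al k j / a j.
have be0 k j : (k < r)%N -> 0 <= be k j.
  by move=> kr; rewrite divr_ge0 // al0.
have beE k j : (k < r)%N -> be k j * a j = al k j.
  move=> kr; rewrite /be; have [aj0|ajn0] := eqVneq (a j) 0; last by rewrite divfK.
  have al_ge0 (k' : 'I_r) : true -> 0 <= al k' j by move=> _; exact: al0.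
  by have /= -> := psumr_eq0P al_ge0 aj0 (i := Ordinal kr) isT; rewrite !mul0r.
have sum_be j : \sum_(k < r) be k j <= 1.
  rewrite -mulr_suml -/(a j); have [->|ajn0] := eqVneq (a j) 0.
    by rewrite mul0r ler01.
  by rewrite mulfV.
have zc j : (j < n)%N -> nonneg (comb b (z j)).
  by move=> /zP[z0 _]; exact: comb_nonneg.
pose u' k := \sum_(j < n) be k j *: comb b (a j *: w j - z j).
have diffE k : (k < r)%N -> u k - u' k = \sum_(j < n) be k j *: comb b (z j).
  move=> kr; rewrite uE // /u' -sumrB; apply: eq_bigr => j _.
  have -> : comb b (a j *: w j - z j) = a j *: comb b (w j) - comb b (z j).
    by rewrite linearB linearZ.
  rewrite scalerBr scalerA beE //.
  by rewrite opprB addrC subrK.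
exists u'; split.
- move=> k kr; split.
    apply: (@cone_sum _ b n (fun j => be k j *: comb b (a j *: w j - z j))).
    move=> j jn; apply: cone_scale; first exact: be0.
    by apply: cone_comb; exact: (zP j jn).2.
  rewrite diffE // => i; rewrite coef_sum sumr_ge0 // => j _.
  by rewrite coefZ mulr_ge0 ?be0 // zc.
- apply: (@le_trans _ _ (\sum_(j < n) N (comb b (z j)))); last first.
    by rewrite sum_u.
  apply: (@le_trans _ _ (\sum_(k < r) \sum_(j < n) be k j * N (comb b (z j)))).
    apply: ler_sum => k _; rewrite diffE //.
    apply: le_trans (latN_sum latN _ _ _) _; apply: ler_sum => j _.
    by rewrite NZ ger0_norm // be0.
  rewrite exchange_big /=; apply: ler_sum => j _.
  by rewrite -mulr_suml ler_piMl // latN_ge0.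
- rewrite sum_u; apply: le_trans le2.
  have u'E : \sum_(k < r) u' k =
      \sum_(j < n) (\sum_(k < r) be k j) *: comb b (a j *: w j - z j).
    by rewrite /u' exchange_big /=; apply: eq_bigr => j _; rewrite [RHS]scaler_suml.
  have rest0 j : (j < n)%N -> nonneg (comb b (a j *: w j - z j)).
    by move=> /zP[_ ?]; exact: comb_nonneg.
  have sum_be0 j : 0 <= \sum_(k < r) be k j by rewrite sumr_ge0 // => k _; exact: be0.
  rewrite u'E linear_sum; apply: latN_mono => // i.
    by rewrite coef_sum sumr_ge0 // => j _; rewrite coefZ mulr_ge0 // rest0.
  rewrite -sumrB coef_sum sumr_ge0 // => j _.
  rewrite -[X in X - _]scale1r -scalerBl coefZ mulr_ge0 ?rest0 //.
  by rewrite subr_ge0.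
Qed.

End BlockCoordinates.

(** A tail of a block sequence of [v] starts so far to the right that it is
    built from [w]. *)
Lemma nonsplitting_coarser (R : realType) (N : {poly R} -> R) (C : R)
    (v w : nat -> {poly R}) :
  block_seq v -> eventually_blocks_of v w ->
  (forall x, block_seq x -> blocks_of x w -> ~ splitting N C x w) ->
  forall x, block_seq x -> blocks_of x v -> ~ splitting N C x v.
Proof.
move=> bv /(eventually_blocks_cone bv)[M Mw] nosplit x bx xv split_x.
pose y j := x (j + M)%N.
have yfrom j : supported_from M (y j).
  move=> i iM; apply: (block_seq_from bx).
  exact: leq_trans iM (leq_addl _ _).
have by_ : block_seq y.
  have [x0 xn0 xs] := bx; split=> [j|j|j k i i' jk]; [exact: x0|exact: xn0|].
  by apply: xs; rewrite ltn_add2r.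
have conefrom u : cone y u -> supported_from M u.
  move=> [n [a [_ ->]]] i iM; rewrite coef_sum big1 // => j _.
  by rewrite coefZ yfrom ?mulr0.
apply: (nosplit y by_) => [j|r u uP].
  by apply: Mw; [exact: xv | exact: yfrom].
have [|u' [u'P le1 le2]] := split_x r u.
  move=> k kr; apply: cone_trans (uP k kr) => j; exact: cone_mem.
exists u'; split=> // k kr; have [vu' uu'] := u'P k kr; split=> //.
apply: Mw => // i iM; apply/le_anti/andP; split; last first.
  exact: (cone_nonneg bv vu').
by have := uu' i; rewrite coefB (conefrom _ (uP k kr)) ?sub0r ?oppr_ge0.
Qed.

Theorem hereditarily_nonsplitting_blocks (R : realType) (N : {poly R} -> R)
    (b0 : nat -> {poly R}) : lattice_norm N -> no_l1 N -> block_seq b0 ->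
  exists b, [/\ block_seq b, blocks_of b b0 &
    forall (C : R) w, 0 <= C -> block_seq w -> blocks_of w b ->
      ~ splitting N C w b].
Proof.
move=> latN noL1 bb0.
pose P n v := forall w, block_seq w -> blocks_of w v ->
  ~ splitting N (n%:R : R) w v.
have [| |b [bb bb0' bP]] := @diagonal_blocks R b0 P _ _ b0 bb0 (cone_mem b0).
- move=> n v w bv _ vw; exact: nonsplitting_coarser.
- move=> n w bw _; exact: nonsplitting_blocks.
exists b; split=> // C w C0 bw wb split_w.
have [n Cn] : exists n : nat, C <= n%:R.
  by exists (Num.bound C); exact: ltW (archi_boundP C0).
apply: (bP n w bw wb) => r u /split_w[u' [u'P le1 le2]].
exists u'; split=> //; apply: le_trans le1 _; rewrite ler_wpM2r //.
exact: latN_ge0.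
Qed.

(** * Flat functionals *)

Section FlatFunctional.
Variables (R : realType) (M : {poly R} -> R).
Hypothesis latM : lattice_norm M.

Definition in_block (cut : nat -> nat) (j : nat) (p : {poly R}) : Prop :=
  forall i, p`_i != 0 -> (cut j <= i < cut j.+1)%N.

Lemma cut_le (cut : nat -> nat) : (forall j, (cut j < cut j.+1)%N) ->
  forall j k, (j <= k)%N -> (cut j <= cut k)%N.
Proof.
move=> cutS j k; elim: k => [|k IH]; first by rewrite leqn0 => /eqP ->.
rewrite leq_eqVlt => /predU1P[->//|/IH /leq_trans]; apply; exact: ltnW.
Qed.

Lemma cut_unique (cut : nat -> nat) : (forall j, (cut j < cut j.+1)%N) ->
  forall i j k, (cut j <= i < cut j.+1)%N -> (cut k <= i < cut k.+1)%N -> j = k.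
Proof.
move=> cutS i j k /andP[ji ij] /andP[ki ik].
apply/eqP; rewrite eqn_leq; apply/andP; split.
  rewrite leqNgt; apply/negP => /(cut_le cutS) /leq_trans /(_ ji).
  by rewrite leqNgt ik.
rewrite leqNgt; apply/negP => /(cut_le cutS) /leq_trans /(_ ki).
by rewrite leqNgt ij.
Qed.

Lemma coef_sum_block cut n (f : nat -> {poly R}) i j :
  (forall j, (cut j < cut j.+1)%N) ->
  (forall j, (j < n)%N -> in_block cut j (f j)) ->
  (j < n)%N -> (cut j <= i < cut j.+1)%N -> (\sum_(k < n) f k)`_i = (f j)`_i.
Proof.
move=> cutS fb jn ij; rewrite coef_sum (bigD1 (Ordinal jn)) //= big1 ?addr0 //.
move=> k /eqP nkj; apply/eqP/negPn/negP => /(fb _ (ltn_ord k)) ik.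
by apply: nkj; apply: val_inj; exact: cut_unique cutS _ _ _ ik ij.
Qed.

Lemma coef_sum_noblock cut n (f : nat -> {poly R}) i :
  (forall j, (j < n)%N -> in_block cut j (f j)) ->
  (forall j, (j < n)%N -> ~~ (cut j <= i < cut j.+1)%N) ->
  (\sum_(k < n) f k)`_i = 0.
Proof.
move=> fb noj; rewrite coef_sum big1 // => k _.
apply/eqP/negPn/negP => /(fb _ (ltn_ord k)).
by rewrite (negPf (noj _ (ltn_ord k))).
Qed.

Lemma clip_norm_le (Z Y : R) : 0 <= Y ->
  `|Num.min (Num.max Z 0) Y| <= `|Z| /\
  `|Y - Num.min (Num.max Z 0) Y| <= `|Y - Z|.
Proof.
move=> Y0; have [Z0|Z0] := leP Z 0.
  rewrite min_l // normr0 subr0; split=> //.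
  by rewrite !ger0_norm; lra.
have [ZY|YZ] := leP Z Y; first by split.
rewrite subrr normr0; split=> //.
by rewrite !ger0_norm //; lra.
Qed.

Definition clip (z y : {poly R}) : {poly R} :=
  \poly_(i < size y) Num.min (Num.max z`_i 0) y`_i.

Lemma coef_clip z y i : nonneg y ->
  (clip z y)`_i = Num.min (Num.max z`_i 0) y`_i.
Proof.
move=> y0; rewrite coef_poly; case: ltnP => // yi.
by rewrite [y`_i]nth_default // min_r // le_max lexx orbT.
Qed.

(** By duality the functional exists unless [y] is closer than 1/2 to a sum of
    blocks of small total norm. Clipping these between 0 and [a j *: w j]
    decreases all norms involved and yields an indexed splitting. The functional
    may be made nonnegative because the norm depends on absolute values only. *)
Lemma flat_functional (cut : nat -> nat) (w : nat -> {poly R}) (delta : R) :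
  (forall C w', 0 <= C -> block_seq w' -> ~ indexed_splitting M C w') ->
  (forall j, (cut j < cut j.+1)%N) -> block_seq w ->
  (forall j, in_block cut j (w j)) -> 0 < delta ->
  exists k (a phi : nat -> R),
    [/\ forall j, 0 <= a j, forall i, 0 <= phi i,
        M (\sum_(j < k) a j *: w j) = 1,
        (forall p : {poly R}, \sum_(i < size p) phi i * `|p`_i| <= M p) /\
        (forall j (p : {poly R}), (j < k)%N -> in_block cut j p ->
           \sum_(i < size p) phi i * `|p`_i| <= delta * M p) &
        1 / 2 <= comb phi (\sum_(j < k) a j *: w j) :> R^o].
Proof.
have [ND NZ Nmono Ninj] := latM.
move=> nosplit cutS bw wb delta0; have [w0 _ _] := bw.
pose C := (2 * delta)^-1.
have C0 : 0 <= C by rewrite invr_ge0; lra.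
have /existsNP[k /existsNP[a /not_implyP[a0 noz]]] := nosplit C w C0 bw.
pose y0 := \sum_(j < k) a j *: w j.
have My0 : 0 < M y0.
  rewrite lt_neqAle latN_ge0 // andbT eq_sym; apply/eqP => M0; apply: noz.
  exists (fun=> 0); rewrite -/y0 M0 !mulr0; split.
  - move=> j _; split=> i; first by rewrite coef0.
    by rewrite subr0 coefZ mulr_ge0 // w0.
  - by rewrite big1 // => *; rewrite latN0.
  - have -> : \sum_(j < k) (a j *: w j - 0) = y0.
      by apply: eq_bigr => j _; rewrite subr0.
    by rewrite M0.
pose c j := (M y0)^-1 * a j.
have c0 j : 0 <= c j by rewrite mulr_ge0 // invr_ge0 ltW.
pose y := \sum_(j < k) c j *: w j.
have yE : y = (M y0)^-1 *: y0.
  by rewrite scaler_sumr; apply: eq_bigr => j _; rewrite scalerA.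
have My : M y = 1.
  by rewrite yE NZ gtr0_norm ?invr_gt0 // mulVf // gt_eqF.
have y_coef0 i : 0 <= y`_i.
  by rewrite coef_sum sumr_ge0 // => j _; rewrite coefZ mulr_ge0 // w0.
have cw0 j : nonneg (c j *: w j) by move=> i; rewrite coefZ mulr_ge0 // w0.
have cwb j : in_block cut j (c j *: w j).
  by move=> i; rewrite coefZ mulf_eq0 negb_or => /andP[_]; exact: wb.
(* The K-functional of [y] for [M] and the sum of the norms of the blocks. *)
have far (z : nat -> {poly R}) : (forall j, (j < k)%N -> in_block cut j (z j)) ->
    1 / 2 <= M (y - \sum_(j < k) z j) + delta * \sum_(j < k) M (z j).
  move=> zb; rewrite leNgt; apply/negP => lt_half; apply: noz.
  pose q j := clip (z j) (c j *: w j).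
  have qE j i : (q j)`_i = Num.min (Num.max (z j)`_i 0) (c j *: w j)`_i.
    by apply: coef_clip.
  have Mq j : M (q j) <= M (z j).
    by apply: Nmono => i; rewrite qE; exact: (clip_norm_le _ (cw0 j i)).1.
  have rest : M (\sum_(j < k) (c j *: w j - q j)) <= M (y - \sum_(j < k) z j).
    rewrite /y -sumrB; apply: Nmono => i.
    have qb j : (j < k)%N -> in_block cut j (c j *: w j - q j).
      move=> jk i'; rewrite coefB qE => ne; apply: (cwb j); move: ne.
      apply: contra => /eqP ->; rewrite min_r ?subrr //.
      by rewrite le_max lexx orbT.
    have zb' j : (j < k)%N -> in_block cut j (c j *: w j - z j).
      move=> jk i'; rewrite coefB => ne.
      have [ci|ci] := eqVneq (c j *: w j)`_i' 0; last exact: cwb.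
      by apply: (zb j jk); apply: contra ne => /eqP ->; rewrite ci subr0.
    have [[j [jk ij]]|none] := pselect (exists j, (j < k)%N /\
        (cut j <= i < cut j.+1)%N).
      rewrite (coef_sum_block cutS qb jk ij) (coef_sum_block cutS zb' jk ij).
      by rewrite !coefB qE; exact: (clip_norm_le _ (cw0 j i)).2.
    have noj j : (j < k)%N -> ~~ (cut j <= i < cut j.+1)%N.
      by move=> jk; apply/negP => ij; apply: none; exists j.
    by rewrite (coef_sum_noblock qb noj) (coef_sum_noblock zb' noj).
  exists (fun j => M y0 *: q j); split.
  - move=> j jk; have aE : a j = M y0 * c j by rewrite mulrA mulfV ?mul1r // gt_eqF.
    split=> i; first by rewrite coefZ mulr_ge0 ?(ltW My0) // qE le_min le_max lexx orbT cw0.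
    rewrite aE -scalerA -scalerBr coefZ mulr_ge0 ?(ltW My0) // coefB qE.
    by rewrite subr_ge0 ge_min lexx orbT.
  - rewrite -/y0 mulrC.
    have -> : \sum_(j < k) M (M y0 *: q j) = M y0 * \sum_(j < k) M (q j).
      by rewrite mulr_sumr; apply: eq_bigr => j _; rewrite NZ gtr0_norm.
    rewrite ler_pM2l //; apply: (@le_trans _ _ (\sum_(j < k) M (z j))).
      by apply: ler_sum => j _; exact: Mq.
    rewrite /C invfM -div1r ler_pdivlMr // mulrC.
    by have := latN_ge0 latM (y - \sum_(j < k) z j) => *; lra.
  - have -> : \sum_(j < k) (a j *: w j - M y0 *: q j) =
        M y0 *: \sum_(j < k) (c j *: w j - q j).
      rewrite scaler_sumr; apply: eq_bigr => j _.
      by rewrite scalerBr scalerA mulrA mulfV ?mul1r // gt_eqF.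
    rewrite NZ gtr0_norm // mulrC ler_pM2r //; apply: le_trans rest _.
    have := @sumr_ge0 _ _ (index_enum 'I_k) xpredT (fun j => M (z j))
      (fun j _ => latN_ge0 latM _).
    move=> /(mulr_ge0 (ltW delta0)) => *; lra.
(* The cone asks for [F y >= 1 / 2] and for [F z >= - delta * M z] on blocks. *)
pose G := [set g : {poly R} * R | exists t (z : nat -> {poly R}),
  [/\ 0 <= t, forall j, (j < k)%N -> in_block cut j (z j),
      g.1 = t *: y + \sum_(j < k) z j &
      g.2 <= t / 2 - delta * \sum_(j < k) M (z j)]].
have block_lin s j (p q : {poly R}) : in_block cut j p -> in_block cut j q ->
    in_block cut j (s *: p + q).
  move=> pb qb i; rewrite coefD coefZ; have [p0|pn0 _] := eqVneq p`_i 0.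
    by rewrite p0 mulr0 add0r; exact: qb.
  exact: pb.
have block0 j : in_block cut j 0 by move=> i; rewrite coef0 eqxx.
have coneG : convex_cone G.
  split.
  - exists 0, (fun=> 0); split=> //=; first by rewrite scale0r add0r big1.
    by rewrite big1 ?mulr0 ?mul0r ?subr0 // => *; rewrite latN0.
  - move=> g h [t [z [t0 zb g1 g2]]] [s [x [s0 xb h1 h2]]].
    exists (t + s), (fun j => z j + x j); split=> /=.
    + exact: addr_ge0.
    + by move=> j jk; rewrite -[z j]scale1r; apply: block_lin; [exact: zb|exact: xb].
    + by rewrite g1 h1 big_split /= scalerDl addrACA.
    + have : \sum_(j < k) M (z j + x j) <=
          \sum_(j < k) M (z j) + \sum_(j < k) M (x j).
        by rewrite -big_split; apply: ler_sum => j _; exact: ND.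
      move=> /(ler_wpM2l (ltW delta0)); rewrite mulrDr => *; lra.
  - move=> s g s0 [t [z [t0 zb g1 g2]]].
    exists (s * t), (fun j => s *: z j); split=> /=.
    + exact: mulr_ge0.
    + by move=> j jk; rewrite -[_ *: _]addr0; apply: block_lin; [exact: zb|exact: block0].
    + by rewrite g1 scalerDr scalerA; congr (_ + _); rewrite scaler_sumr.
    + have -> : \sum_(j < k) M (s *: z j) = s * \sum_(j < k) M (z j).
        by rewrite mulr_sumr; apply: eq_bigr => j _; rewrite NZ ger0_norm.
      by have := ler_wpM2l s0 g2; rewrite mulrBr mulrCA mulrA => *; lra.
have sM : sublinear M.
  by split=> [|t x t0]; [exact: ND | rewrite NZ ger0_norm].
have GM g : G g -> g.2 <= M g.1.
  move=> [t [z [t0 zb -> g2]]]; apply: le_trans g2 _.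
  have [->|tn0] := eqVneq t 0.
    rewrite mul0r scale0r add0r add0r; apply: le_trans (latN_ge0 latM _).
    rewrite oppr_le0 mulr_ge0 ?(ltW delta0) // sumr_ge0 // => j _.
    exact: latN_ge0.
  have tgt0 : 0 < t by rewrite lt_neqAle eq_sym tn0.
  have zb' j : (j < k)%N -> in_block cut j ((- t^-1) *: z j).
    by move=> jk; rewrite -[_ *: _]addr0; apply: block_lin; [exact: zb|exact: block0].
  have := far _ zb'; rewrite -scaler_sumr scaleNr opprK.
  have -> : \sum_(j < k) M ((- t^-1) *: z j) = t^-1 * \sum_(j < k) M (z j).
    rewrite mulr_sumr; apply: eq_bigr => j _.
    by rewrite NZ normrN gtr0_norm // invr_gt0.
  have -> : y + t^-1 *: \sum_(j < k) z j = t^-1 *: (t *: y + \sum_(j < k) z j).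
    by rewrite scalerDr scalerA mulVf // scale1r.
  rewrite NZ gtr0_norm ?invr_gt0 // => /(ler_wpM2l (ltW tgt0)).
  set A := M _; set B := \sum_(j < k) _.
  have -> : t * (t^-1 * A + delta * (t^-1 * B)) = A + delta * B by field.
  by move=> *; lra.
have [F [FM FG]] := mazur_orlicz sM coneG GM.
(* The polynomial [tw p] is [p] with the signs of [F] on its coefficients. *)
pose phi i : R := `|F 'X^i : R|.
pose tw (p : {poly R}) : {poly R} :=
  \poly_(i < size p) (Num.sg (F 'X^i : R) * `|p`_i|).
have tw_le (p : {poly R}) i : `|(tw p)`_i| <= `|p`_i|.
  rewrite coef_poly; case: ifP => _; last by rewrite normr0.
  by rewrite normrM normr_id ler_piMl // normr_sg; case: (_ != 0).
have F_tw (p : {poly R}) : (F (tw p) : R) = \sum_(i < size p) phi i * `|p`_i|.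
  rewrite {1}/tw poly_def linear_sum; apply: eq_bigr => i _.
  rewrite linearZ /phi (normrEsg (F 'X^i : R)).
  exact: (mulrAC (Num.sg (F 'X^i : R)) `|p`_i| (F 'X^i : R)).
exists k, c, phi; split=> //.
- by move=> i; exact: normr_ge0.
- split=> [p|j p jk pb].
    by rewrite -F_tw; apply: le_trans (FM _) _; apply: Nmono; exact: tw_le.
  rewrite -F_tw.
  have Gtw : G (- tw p, - (delta * M (tw p))).
    exists 0, (fun j' => if j' == j then - tw p else 0); split=> //=.
    + move=> j' _; case: eqP => // -> i; rewrite coefN oppr_eq0 => twi.
      apply: pb; apply: contra twi => /eqP pi0.
      by have := tw_le p i; rewrite pi0 normr0 normr_le0.
    + rewrite scale0r add0r (bigD1 (Ordinal jk)) //= eqxx big1 ?addr0 // => i /eqP ni.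
      by case: eqP => // ij; case: ni; apply: val_inj.
    + rewrite mul0r add0r lerN2 ler_wpM2l ?(ltW delta0) //.
      rewrite (bigD1 (Ordinal jk)) //= eqxx big1 ?addr0 ?latNN // => i /eqP ni.
      case: eqP => [ij|_]; last by rewrite latN0.
      by case: ni; apply: val_inj.
  have := FG _ Gtw; rewrite /= linearN lerN2 => le_F.
  by apply: le_trans le_F _; rewrite ler_wpM2l ?(ltW delta0) //; apply: Nmono; exact: tw_le.
- have Gy : G (y, 1 / 2).
    exists 1, (fun=> 0); split=> //=; first by rewrite scale1r big1 ?addr0.
    rewrite big1 ?mulr0 ?subr0 // => *; exact: latN0.
  apply: le_trans (FG _ Gy) _; rewrite /= {1}[y]poly_comb linear_comb.
  rewrite -/y /comb; apply: ler_sum => i _.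
  by rewrite ler_wpM2l //; exact: ler_norm.
Qed.

End FlatFunctional.

(** * Reflexive spaces with an unconditional basis *)

Section Reflexive.
Variables (R : realType) (A : normedModType R) (e : nat -> A).
Hypothesis e_basis : one_unconditional_basis e.

Lemma sum_norm_mono n (c d : nat -> R) : (forall i, `|c i| <= `|d i|) ->
  `|\sum_(i < n) c i *: e i| <= `|\sum_(i < n) d i *: e i|.
Proof.
move=> cd; have [_ unc] := e_basis.
pose mix m i := if (i < m)%N then c i else d i.
suff mixP m : (m <= n)%N ->
    `|\sum_(i < n) mix m i *: e i| <= `|\sum_(i < n) d i *: e i|.
  have <- : \sum_(i < n) mix n i *: e i = \sum_(i < n) c i *: e i.
    by apply: eq_bigr => i _; rewrite /mix ltn_ord.
  exact: mixP.
elim: m => [_|m IH mn].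
  by rewrite le_eqVlt; apply/orP; left; apply/eqP; congr `|_|; apply: eq_bigr.
apply: le_trans (IH (ltnW mn)).
(* Replacing [d m] by [c m] is a convex combination of keeping [d m] and of
   flipping its sign, and the flip preserves the norm. *)
have [dm0|dmn0] := eqVneq (d m) 0.
  have cm0 : c m = 0 by apply/normr0_eq0/le_anti; rewrite normr_ge0 andbT -(normr0 R) -dm0.
  rewrite le_eqVlt; apply/orP; left; apply/eqP; congr `|_|; apply: eq_bigr => i _.
  rewrite /mix ltnS leq_eqVlt; case: eqVneq => [->|_] //=.
  by rewrite ltnn cm0 dm0.
pose t := (1 + c m / d m) / 2.
have ratio : `|c m / d m| <= 1.
  by rewrite normrM normfV ler_pdivrMr ?normr_gt0 // mul1r.
have [t0 t1] : 0 <= t /\ 0 <= 1 - t.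
  by move: ratio; rewrite ler_norml /t => /andP[? ?]; split; lra.
pose flip i := (-1) ^+ (i == m) * mix m i.
have -> : \sum_(i < n) mix m.+1 i *: e i =
    t *: (\sum_(i < n) mix m i *: e i) + (1 - t) *: (\sum_(i < n) flip i *: e i).
  rewrite !scaler_sumr -big_split; apply: eq_bigr => i _ /=.
  rewrite !scalerA -scalerDl; congr (_ *: _).
  rewrite /flip /mix ltnS leq_eqVlt; case: eqVneq => [->|_] /=.
    by rewrite ltnn expr1 /t; field.
  by rewrite expr0 mul1r -mulrDl addrC subrK mul1r.
apply: le_trans (ler_normD _ _) _; rewrite (normrZ t) (normrZ (1 - t)) (ger0_norm t0) (ger0_norm t1).
by rewrite (unc n (mix m) (fun i => i == m)) -mulrDl addrC subrK mul1r.
Qed.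

Lemma expansion_comb (p : {poly R}) : expansion e (comb e p) (fun i => p`_i).
Proof.
apply: cvg_near_cst; exists (size p) => // n /= pn.
by rewrite /series /= big_mkord (comb_widen e pn).
Qed.

Lemma expansion_unique x c d : expansion e x c -> expansion e x d -> c = d.
Proof.
by have [sb _] := e_basis; have [c' [_ cu]] := sb x => /cu <- /cu <-.
Qed.

Lemma lattice_norm_basis : lattice_norm (fun p => `|comb e p|).
Proof.
split=> [p q|t p|p q pq|p].
- by rewrite linearD; exact: ler_normD.
- by rewrite linearZ /= normrZ.
- rewrite !(@comb_widen _ _ e _ (maxn (size p) (size q))) ?leq_maxl ?leq_maxr //.
  exact: (@sum_norm_mono _ (fun i => p`_i) (fun i => q`_i)).
- move=> /normr0_eq0 p0; have := @expansion_comb p; rewrite p0.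
  have := @expansion_comb 0; rewrite linear0 => ex0 ep.
  apply/polyP => i; have := expansion_unique ep ex0.
  by move/(congr1 (fun f : nat -> R => f i)).
Qed.

Lemma dual_bound (phi : A -> R) : dual phi -> 0 <= dual_norm phi /\
  forall x, `|phi x| <= dual_norm phi * `|x|.
Proof.
move=> [phiL phiC].
pose lin := GRing.isLinear.Build R A R^o *:%R phi phiL.
pose f : {linear A -> R^o} := HB.pack phi lin.
have /bounded_funP/(_ 1)[B fB] : bounded_near f (nbhs (0 : A)).
  by apply: (@continuous_linear_bounded _ _ _ 0); exact: phiC.
pose S := [set `|phi x| | x in unit_ball A].
have phi0 : phi 0 = 0 by exact: (linear0 f).
have supS : has_sup S.
  split; first by exists `|phi 0|; exists 0; rewrite // /unit_ball /= normr0.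
  by exists B => _ [x x1 <-]; exact: fB.
have le_sup x : `|x| <= 1 -> `|phi x| <= dual_norm phi.
  by move=> x1; apply: ub_le_sup; [exact: supS.2 | exists x].
split=> [|x].
  by apply: le_trans (le_sup 0 _); rewrite ?normr0.
have [->|xn0] := eqVneq x 0; first by rewrite phi0 !normr0 mulr0.
have nx : 0 < `|x| by rewrite normr_gt0.
have := le_sup (`|x|^-1 *: x).
rewrite normrZ normfV normr_id mulVf ?gt_eqF // lexx => /(_ isT).
have -> : phi (`|x|^-1 *: x) = `|x|^-1 * phi x by exact: (linearZ_LR f).
by rewrite normrM normfV normr_id ler_pdivrMl // mulrC.
Qed.

Lemma ultra_fmap (T T' : Type) (f : T -> T') (U : set_system T) :
  UltraFilter U -> UltraFilter (f @ U).
Proof.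
move=> ultraU; split; first exact: fmap_proper_filter.
move=> G properG UG; rewrite predeqE => S; split; last exact: UG.
move=> GS; have [//|UnS] := in_ultra_setVsetC (f @^-1` S) ultraU.
have GnS : G (~` S) by exact: UG.
have : G (S `&` ~` S) by exact: filterI.
by rewrite setICr => /(@filter_not_empty _ _ properG).
Qed.

(** Tested against functionals, a bounded sequence converges along any
    ultrafilter; reflexivity will represent the limit by a vector. *)
Lemma limit_in_bidual (x : nat -> A) (U : set_system nat) (B : R) :
  UltraFilter U -> (forall l, `|x l| <= B) ->
  (forall phi : A -> R, dual phi -> cvg (phi (x l) @[l --> U])) /\
  bidual (fun phi : A -> R => lim (phi (x l) @[l --> U])).
Proof.
move=> ultraU xB.
have properU : ProperFilter U by exact: ultra_proper.
have phiB (phi : A -> R) : dual phi ->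
    exists2 r, `|r| <= B * dual_norm phi & phi (x l) @[l --> U] --> r.
  move=> dphi; have [dn0 dn] := dual_bound dphi.
  pose M := B * dual_norm phi.
  have := @segment_compact R (- M) M; rewrite compact_ultra => cpt.
  have [||r [rM rlim]] := cpt ((fun l => phi (x l)) @ U).
  - exact: ultra_fmap.
  - apply: (@filterE _ U) => l; rewrite /= in_itv /= -ler_norml.
    by apply: le_trans (dn _) _; rewrite mulrC ler_wpM2r.
  - by exists r => //; move: rM; rewrite /= in_itv /= -ler_norml.
have cvgU (phi : A -> R) : dual phi -> cvg (phi (x l) @[l --> U]).
  by move=> /phiB[r _ rlim]; apply/cvg_ex; exists r.
split=> //; split.
  move=> c phi psi dphi dpsi.
  apply: cvg_lim; first exact: norm_hausdorff.
  by apply: cvgD; [apply: cvgMl_tmp|]; exact: cvgU.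
exists B => phi /phiB[r rB rlim].
by rewrite (cvg_lim _ rlim) // mulrC.
Qed.

(** Let [z] represent the limit of the [x l] along a free ultrafilter. The l1
    estimate provides a functional of norm at most [D] that vanishes on the
    first [n] basis vectors and is at least 1 at [x l] for [n <= l], hence at
    [z]. For large [n] this contradicts the expansion of [z]. *)
Lemma no_l1_reflexive : reflexive_space A -> no_l1 (fun p => `|comb e p|).
Proof.
move=> reflA x D x_from x_le2 l1.
have [_ _ Nmono _] := lattice_norm_basis.
have [U [ultraU toU]] := @ultraFilterLemma nat \oo _.
have properU : ProperFilter U by exact: ultra_proper.
have [cvgU bidualU] := limit_in_bidual ultraU x_le2.
have [z zP] := reflA _ bidualU.
have [[c [zc _]] _] := (e_basis.1 z, tt).
have D0 : 0 < D.
  have := l1 1%N (fun=> 1) (fun=> ler01); rewrite !big_ord1 scale1r => D1.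
  rewrite ltNge; apply/negP => D0.
  by have := mulr_le0_ge0 D0 (normr_ge0 (comb e (x 0%N))) => *; lra.
have [n near_z] : exists n, `|z - \sum_(i < n) c i *: e i| < D^-1.
  have Dinv : 0 < D^-1 by rewrite invr_gt0.
  have /cvgrPdist_lt/(_ _ Dinv)[n _ nP] := zc.
  by exists n; have := nP n (leqnn n); rewrite /series /= big_mkord.
(* The polynomials [t] and [r] hold the coefficients at [x l], [n <= l], and at
   the first [n] basis vectors. *)
pose T (t r : {poly R}) := comb (fun l => x (n + l)%N) t + r.
have TD t s r q : T (t + s) (r + q) = T t r + T s q.
  by rewrite /T linearD addrACA.
have TZ a t r : T (a *: t) (a *: r) = a *: T t r.
  by rewrite /T linearZ scalerDr.
pose G := [set g : A * R | exists t r : {poly R},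
  [/\ nonneg t, (size r <= n)%N, g.1 = comb e (T t r) &
      g.2 = comb (fun=> 1 : R^o) t]].
have coneG : convex_cone G.
  split.
  - exists 0, 0; rewrite size_poly0 /T /= !linear0 addr0 linear0.
    by split=> // i; rewrite coef0.
  - move=> g h [t [r [t0 rn g1 g2]]] [s [q [s0 qn h1 h2]]].
    exists (t + s), (r + q); split=> [i||/=|/=].
    + by rewrite coefD addr_ge0.
    + by apply: leq_trans (size_polyD _ _) _; rewrite geq_max rn.
    + by rewrite g1 h1 TD; exact/esym/(raddfD (comb e)).
    + by rewrite g2 h2; exact/esym/(raddfD (comb (fun=> 1 : R^o))).
  - move=> s g s0 [t [r [t0 rn g1 g2]]]; exists (s *: t), (s *: r); split=> [i||/=|/=].
    + by rewrite coefZ mulr_ge0.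
    + exact: leq_trans (size_scale_leq _ _) rn.
    + by rewrite g1 TZ; exact/esym/(linearZ_LR (comb e)).
    + by rewrite g2; exact/esym/(linearZ_LR (comb (fun=> 1 : R^o))).
have subD : sublinear (fun v : A => D * `|v|).
  split=> [v w|t v t0]; first by rewrite -mulrDr ler_pM2l // ler_normD.
  by rewrite normrZ ger0_norm // mulrCA.
have GD g : G g -> g.2 <= D * `|g.1|.
  move=> [t [r [t0 rn -> ->]]].
  pose s l := if (l < n)%N then 0 else t`_(l - n).
  have s0 l : 0 <= s l by rewrite /s; case: ifP.
  have := l1 (n + size t)%N s s0; rewrite big_split_ord /= big1 ?add0r; last first.
    by move=> i _; rewrite /s ltn_ord.
  have -> : \sum_(i < size t) s (n + i)%N = comb (fun=> 1 : R^o) t.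
    apply: eq_bigr => i _; rewrite /s ltnNge leq_addr /= addKn.
    by rewrite /GRing.scale /= mulr1.
  move/le_trans; apply; rewrite ler_pM2l //.
  have -> : \sum_(l < n + size t) s l *: x l = comb (fun l => x (n + l)%N) t.
    rewrite big_split_ord /= big1 ?add0r => [|i _]; last by rewrite /s ltn_ord scale0r.
    by apply: eq_bigr => i _; rewrite /s ltnNge leq_addr /= addKn.
  apply: Nmono => i; rewrite coefD; have [lt_in|le_ni] := ltnP i n.
    suff -> : (comb (fun l => x (n + l)%N) t)`_i = 0 by rewrite normr0.
    rewrite coef_sum big1 // => j _.
    by rewrite coefZ x_from ?mulr0 // (leq_trans lt_in) // leq_addr.
  by rewrite [r`_i]nth_default ?addr0 // (leq_trans rn).
have [psi [psiD psiG]] := mazur_orlicz subD coneG GD.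
have psi_bound v : `|psi v : R| <= D * `|v|.
  rewrite ler_norml psiD andbT lerNl.
  by have := psiD (- v); rewrite linearN normrN.
have dual_psi : dual (psi : A -> R).
  split; first by move=> s v w; rewrite linearP.
  apply: (@bounded_linear_continuous _ _ R^o psi).
  apply/bounded_funP => r; exists (D * r) => v vr.
  by apply: le_trans (psi_bound v) _; rewrite ler_pM2l.
have psi_x l : (n <= l)%N -> 1 <= (psi (comb e (x l)) : R).
  move=> nl; apply: (psiG (comb e (x l), 1)).
  exists 'X^(l - n), 0; rewrite size_poly0 /T /= !combXn addr0 subnKC //.
  by split=> // i; rewrite coefXn ler0n.
have psi_e i : (i < n)%N -> (psi (e i) : R) = 0.
  move=> lt_in; have Ge s : 0 <= (psi (s *: e i) : R).
    apply: (psiG (s *: e i, 0)); exists 0, (s *: 'X^i).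
    rewrite /T /= !linear0 add0r linearZ /= combXn; split=> // [j|].
      by rewrite coef0.
    by apply: leq_trans (size_scale_leq _ _) _; rewrite size_polyXn.
  have := Ge 1; have := Ge (-1); rewrite scaleN1r scale1r linearN => *.
  by apply/le_anti/andP; split; [rewrite -oppr_ge0 |].
have psi_z : 1 <= (psi z : R).
  rewrite -(zP _ dual_psi); apply: limr_ge; first exact: cvgU.
  by apply: toU; exists n.
have psi_tail : psi z = psi (z - \sum_(i < n) c i *: e i).
  rewrite linearB linear_sum big1 ?subr0 // => i _.
  by rewrite linearZ_LR psi_e // scaler0.
have := le_lt_trans (psi_bound (z - \sum_(i < n) c i *: e i))
  (_ : _ < D * D^-1); rewrite ltr_pM2l // near_z -psi_tail => /(_ isT).
rewrite mulfV ?gt_eqF // => lt1.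
by have := ler_norm (psi z : R); rewrite leNgt (lt_le_trans lt1 psi_z).
Qed.

End Reflexive.

(** * The block basis *)

Section BlockBasis.
Variables (R : realType) (A : normedModType R) (e : nat -> A).
Hypothesis e_basis : one_unconditional_basis e.

Lemma coords_comb (p : {poly R}) : coords e (comb e p) = (fun i => p`_i).
Proof.
apply: (expansion_unique e_basis (x := comb e p)); last exact: expansion_comb.
by apply: xgetPex; exists (fun i => p`_i); exact: expansion_comb.
Qed.

(** Normalizing a nonsplitting block sequence does not change its cone. *)
Theorem nonsplitting_block_basis : reflexive_space A ->
  exists b : nat -> A,
    [/\ normalized_block_sequence e b,
        lattice_norm (fun p => `|comb b p|) &
        forall C w, 0 <= C -> block_seq w ->
          ~ indexed_splitting (fun p => `|comb b p|) C w].
Proof.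
move=> reflA; have latN := lattice_norm_basis e_basis.
have noL1 := no_l1_reflexive e_basis reflA.
have bX : block_seq (fun i => 'X^i : {poly R}).
  split=> [j i|j|j k i i' jk]; first by rewrite coefXn ler0n.
    by rewrite monic_neq0 // monicXn.
  by rewrite !coefXn !pnatr_eq0 !eqb0 !negbK => /eqP -> /eqP ->.
have [be [bbe _ be_nosplit]] := hereditarily_nonsplitting_blocks latN noL1 bX.
have [be0 ben0 bes] := bbe.
pose nrm n := `|comb e (be n)|.
have nrm0 n : 0 < nrm n by exact: (latN_gt0 latN (ben0 n)).
pose be' n := (nrm n)^-1 *: be n.
have coef_be' n i : ((be' n)`_i != 0) = ((be n)`_i != 0).
  by rewrite coefZ mulf_eq0 invr_eq0 gt_eqF.
have bbe' : block_seq be'.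
  split=> [j i|j|j k i i' jk]; last by rewrite !coef_be'; exact: bes.
    by rewrite coefZ mulr_ge0 // ?be0 // invr_ge0 ltW.
  by rewrite scaler_eq0 invr_eq0 gt_eqF //=.
have be'be : eventually_blocks_of be' be.
  by exists 0%N => j _; apply: cone_scale (cone_mem _ _); rewrite invr_ge0 ltW.
pose b n := comb e (be' n).
have combb (p : {poly R}) : comb b p = comb e (comb be' p) by rewrite linear_comb.
exists b; split.
- split=> [n|n|m n i j mn].
  + rewrite /b /be' linearZ /= normrZ gtr0_norm ?invr_gt0 // mulVf //.
    by rewrite gt_eqF.
  + apply: (@sub_finite_set _ _ `I_(size (be' n))); last exact: finite_II.
    move=> i; rewrite /basis_support /= coords_comb.
    by apply: contraR; rewrite -leqNgt => /leq_sizeP/(_ i (leqnn i)) ->.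
  + rewrite /basis_support /= !coords_comb; have [_ _] := bbe'; exact.
- have -> : (fun p => `|comb b p|) = (fun p => `|comb e (comb be' p)|).
    by apply/funext => p; rewrite combb.
  exact: (lattice_norm_comb latN bbe').
- move=> C w C0 bw; have [w0 _ _] := bw.
  have -> : (fun p => `|comb b p|) = (fun p => `|comb e (comb be' p)|).
    by apply/funext => p; rewrite combb.
  move=> /(splitting_of_indexed latN bbe' bw).
  apply: (nonsplitting_coarser bbe' be'be) => [x bx xbe||].
  + exact: be_nosplit.
  + exact: (block_seq_comb latN bbe').
  + by move=> j; exact: cone_comb.
Qed.

End BlockBasis.

(** * The tree space *)

Lemma short_words (T : eqType) (entries : seq T) (n : nat) :
  exists W : seq (seq T), forall s : seq T,
    (size s <= n)%N -> {subset s <= entries} -> s \in W.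
Proof.
elim: n => [|n [W IH]]; first by exists [:: [::]] => -[].
exists ([::] :: [seq x :: s | x <- entries, s <- W]) => -[//|x s] sn se.
rewrite in_cons; apply/orP; right; apply/allpairsP; exists (x, s); split=> //=.
  by apply: se; rewrite mem_head.
by apply: IH => // y ys; apply: se; rewrite in_cons ys orbT.
Qed.

Lemma shallow_nodes (n : nat) :
  exists D : seq tree, forall d : tree, (depth d <= n)%N -> d \in D.
Proof.
have [W WP] := short_words (iota 0 (3 ^ (4 * n)).+1) n.
exists (pmap insub W) => d dn; rewrite mem_pmap_sub /=.
apply: WP => // k /(nthP 0%N)[i i_lt <-].
have /andP[_ /allP/(_ i)] := valP d; rewrite mem_iota add0n => /(_ i_lt) le_k.
rewrite mem_iota add0n ltnS; apply: leq_trans le_k _.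
by rewrite leq_exp2l // leq_mul2l (leq_trans i_lt).
Qed.

Section TreeSpace.
Variables (R : realType) (E : normedModType R) (b : nat -> E).
Variables (X : completeNormedModType R) (u : tree -> X).
Hypotheses (latB : lattice_norm (fun p => `|comb b p|)) (Xu : is_XB b u).
Hypothesis b_norm : forall n, `|b n| = 1.

Definition level_norms (s : seq tree) (x : tree -> R) : {poly R} :=
  \sum_(d <- s) `|x d| *: 'X^((depth d).-1).

Lemma depth_gt0 (d : tree) : (0 < depth d)%N.
Proof. by have /andP[] := valP d; rewrite -size_eq0 lt0n. Qed.

Lemma c00_normE (f : c00 R) :
  c00_norm b f = `|\sum_(d <- finsupp f) `|f d| *: b (depth d).-1|.
Proof.
rewrite /c00_norm; congr `|_|.
transitivity (\sum_(n < \max_(d <- finsupp f) depth d)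
    \sum_(d <- finsupp f | depth d == n.+1) `|f d| *: b n).
  by apply: eq_bigr => n _; rewrite scaler_suml.
rewrite (exchange_big_dep xpredT) //= big_seq [RHS]big_seq.
apply: eq_bigr => d df.
have dm : ((depth d).-1 < \max_(d <- finsupp f) depth d)%N.
  by rewrite prednK ?depth_gt0 //; exact: leq_bigmax_seq.
rewrite (bigD1 (Ordinal dm)) /=; last by rewrite prednK // depth_gt0.
rewrite big1 ?addr0 // => n /andP[/eqP dn /eqP nd]; case: nd.
by apply: val_inj; rewrite /= dn.
Qed.

(** Passing to duplicate-free lists of nodes allows zero coefficients to be
    listed and different vectors to share a list. *)
Lemma c00_of_list (s : seq tree) (x : tree -> R) : uniq s ->
  exists f : c00 R, forall (V : zmodType) (g : tree -> R -> V),
    (forall d, g d 0 = 0) ->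
    \sum_(d <- finsupp f) g d (f d) = \sum_(d <- s) g d (x d).
Proof.
move=> us; pose f : c00 R := [fsfun d in [fset d in s]%fset => x d | 0].
have fE d : f d = if d \in s then x d else 0 by rewrite fsfunE !inE.
exists f => V g g0.
have -> : \sum_(d <- s) g d (x d) = \sum_(d <- s | f d != 0) g d (f d).
  rewrite [RHS]big_mkcond big_seq [RHS]big_seq; apply: eq_bigr => d ds.
  by rewrite fE ds; case: eqP => // ->.
rewrite -[RHS]big_filter; apply: perm_big; apply: uniq_perm.
- exact: fset_uniq.
- exact: filter_uniq.
move=> d; rewrite mem_filter mem_finsupp fE.
by case: ifP => ds; rewrite ?andbT ?eqxx ?andbF.
Qed.

Lemma tree_norm (s : seq tree) (x : tree -> R) : uniq s ->
  `|\sum_(d <- s) x d *: u d| = `|comb b (level_norms s x)|.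
Proof.
move=> /(c00_of_list x)[f fs]; have [isom _] := Xu.
have := isom f; rewrite c00_normE /c00_comb.
rewrite (fs _ (fun d r => r *: u d)) => [->|d]; last by rewrite scale0r.
rewrite (fs _ (fun d r => `|r| *: b (depth d).-1)) => [|d]; last first.
  by rewrite normr0 scale0r.
congr `|_|; rewrite linear_sum; apply: eq_bigr => d _.
by rewrite linearZ /= combXn.
Qed.

Lemma tree_dense (v : X) (eta : R) : 0 < eta ->
  exists s x, uniq s /\ `|v - \sum_(d <- s) x d *: u d| < eta.
Proof.
move=> eta0; have [_ dense] := Xu.
have : closure (range (c00_comb u)) v by rewrite dense.
move=> /(_ (ball v eta) (nbhsx_ballx v eta eta0))[_ [[f _ <-]]].
rewrite -ball_normE /= => near_f; exists (finsupp f), f; split=> //.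
exact: fset_uniq.
Qed.

Lemma level_norms_coef s x i :
  (level_norms s x)`_i = \sum_(d <- s | (depth d).-1 == i) `|x d|.
Proof.
rewrite coef_sum [RHS]big_mkcond; apply: eq_bigr => d _ /=.
by rewrite coefZ coefXn eq_sym; case: eqP; rewrite ?mulr1 ?mulr0.
Qed.

Lemma coef_le_norm s x d : uniq s -> d \in s ->
  `|x d| <= `|\sum_(d <- s) x d *: u d|.
Proof.
move=> us ds; rewrite tree_norm //.
have [_ _ Nmono _] := latB.
have -> : `|x d| = `|comb b (`|x d| *: 'X^((depth d).-1))|.
  by rewrite linearZ /= combXn normrZ b_norm mulr1 normr_id.
apply: Nmono => i; rewrite coefZ coefXn level_norms_coef.
have sum0 : 0 <= \sum_(d <- s | (depth d).-1 == i) `|x d|.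
  by apply: sumr_ge0.
rewrite [leRHS]ger0_norm //; case: eqVneq => [->|_]; last first.
  by rewrite mulr0 normr0.
rewrite mulr1 normr_id (big_rem d) //= eqxx lerDl.
exact: sumr_ge0.
Qed.

(** The nodes are enumerated by [pickle], which turns the finite combinations of
    the [u d] into the values of a linear map on polynomials; the graph of the
    functional is then a convex cone below the norm. *)
Lemma tree_functional (f : tree -> R) :
  (forall s x, uniq s ->
     `|\sum_(d <- s) f d * x d| <= `|\sum_(d <- s) x d *: u d|) ->
  exists F : {linear X -> R^o},
    (forall v, `|F v : R| <= `|v|) /\ forall d, (F (u d) : R) = f d.
Proof.
move=> fle.
pose U i : X := oapp u 0 (@pickle_inv tree i).
pose phi i : R^o := oapp f 0 (@pickle_inv tree i).
have combP (V : lmodType R) (g : tree -> V) (p : {poly R}) :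
    comb (fun i => oapp g 0 (@pickle_inv tree i)) p =
    \sum_(d <- pmap (@pickle_inv tree) (iota 0 (size p))) p`_(choice.pickle d) *: g d.
  rewrite big_pmap /comb -(big_mkord xpredT
    (fun i => p`_i *: oapp g 0 (@pickle_inv tree i))) /index_iota subn0.
  apply: eq_bigr => i _; have := @pickle_invK tree i.
  by case: (@pickle_inv tree i) => [d|] /=; [move=> -> | rewrite scaler0].
pose G := [set g : X * R | exists p, g = (comb U p, comb phi p : R)].
have coneG : convex_cone G.
  split.
  - by exists 0; rewrite !linear0.
  - by move=> _ _ [p ->] [q ->]; exists (p + q); rewrite !linearD.
  - by move=> t _ _ [p ->]; exists (t *: p); rewrite !linearZ.
have sub_norm : sublinear (fun v : X => `|v|).
  by split=> [v w|t v t0]; [exact: ler_normD | rewrite normrZ ger0_norm].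
have Gle g : G g -> g.2 <= `|g.1|.
  move=> [p ->] /=; rewrite /U /phi !combP.
  apply: le_trans (ler_norm _) _; set s := pmap _ _.
  have us : uniq s.
    apply: (@pmap_uniq _ _ _ choice.pickle) (iota_uniq _ _); exact: pickle_invK.
  apply: le_trans (fle s (fun d => p`_(choice.pickle d)) us).
  by under eq_bigr => d _ do rewrite /GRing.scale /= mulrC.
have [F [Fle FG]] := mazur_orlicz sub_norm coneG Gle.
have F_at d : (F (u d) : R) = f d.
  have UX : comb U 'X^(choice.pickle d) = u d by rewrite combXn /U pickleK_inv.
  have phiX : comb phi 'X^(choice.pickle d) = f d by rewrite combXn /phi pickleK_inv.
  have Gd t : G (t *: u d, t * f d).
    exists (t *: 'X^(choice.pickle d)); congr pair.
      by rewrite -UX; exact/esym/(linearZ_LR (comb U)).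
    by rewrite -phiX; exact/esym/(linearZ_LR (comb phi)).
  have := FG _ (Gd 1); have := FG _ (Gd (-1)).
  rewrite /= !scaleN1r !scale1r linearN mulN1r mul1r lerN2 => le_f ge_f.
  by apply/le_anti/andP.
exists F; split=> // v; rewrite ler_norml Fle andbT lerNl.
by have := Fle (- v); rewrite linearN normrN.
Qed.

Lemma tree_coordinate (d0 : tree) : exists F : {linear X -> R^o},
  (forall v, `|F v : R| <= `|v|) /\ forall d, (F (u d) : R) = (d == d0)%:R.
Proof.
apply: tree_functional => s x us.
have [ds|nds] := boolP (d0 \in s); last first.
  rewrite big_seq big1 ?normr0 // => d ds.
  by case: eqP nds => [<-|_ _]; rewrite ?ds // mul0r.
rewrite (bigD1_seq d0) //= eqxx mul1r big1 ?addr0 => [|d /negPf ->].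
  exact: coef_le_norm.
by rewrite mul0r.
Qed.

Section InfiniteDimensional.
Variable V : set X.
Hypotheses (subV : linear_subspace V) (infV : infinite_dimensional V).

Lemma infinite_dimensional_kernel (W : set X) (F : {linear X -> R^o}) :
  linear_subspace W -> infinite_dimensional W ->
  linear_subspace (W `&` [set v | F v = 0]) /\
  infinite_dimensional (W `&` [set v | F v = 0]).
Proof.
move=> [W0 Wlin] infW; split.
  split=> [|c v w [Wv Fv] [Ww Fw]]; first by split=> //=; rewrite linear0.
  by split; [exact: Wlin | rewrite /= linearP Fv Fw scaler0 addr0].
move=> [n [v spanv]]; apply: infW.
have [[w0 [Ww0 Fw0]]|allker] := pselect (exists w0, W w0 /\ F w0 != 0).
  exists n.+1, (fun i => oapp v w0 (unlift ord0 i)) => w Ww.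
  pose t : R := F w / F w0.
  have [|c cE] := spanv (- t *: w0 + w).
    split; first exact: Wlin.
    rewrite /= linearP /t /GRing.scale /= mulNr divfK ?addNr //.
  exists (fun i => oapp c t (unlift ord0 i)).
  rewrite big_ord_recl unlift_none /=.
  under eq_bigr do rewrite liftK /=.
  by rewrite -cE addrA scaleNr subrr add0r.
exists n, v => w Ww; apply: spanv; split=> //=.
by apply/eqP/negPn/negP => Fw; apply: allker; exists w.
Qed.

Lemma kernel_vector (I : Type) (D : seq I) (F : I -> {linear X -> R^o}) :
  exists v, [/\ V v, `|v| = 1 & forall i, List.In i D -> (F i v : R) = 0].
Proof.
have [W [subW infW WV WF]] : exists W : set X, [/\ linear_subspace W,
    infinite_dimensional W, W `<=` V &
    forall v i, W v -> List.In i D -> (F i v : R) = 0].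
  elim: D => [|i D [W [subW infW WV WF]]]; first by exists V; split=> // v i _ [].
  have [subW' infW'] := infinite_dimensional_kernel (F i) subW infW.
  exists (W `&` [set v | F i v = 0]); split=> // [v [/WV]//|v j [Wv Fv] /=].
  by case=> [<-//|]; exact: WF.
have [v [Wv vn0]] : exists v, W v /\ v != 0.
  apply: contrapT => allzero; apply: infW; exists 0%N, (fun=> 0) => v Wv.
  exists (fun=> 0); rewrite big_ord0; apply/eqP/negPn/negP => vn0.
  by apply: allzero; exists v.
have Wv1 : W (`|v|^-1 *: v).
  by have := subW.2 `|v|^-1 v 0 Wv subW.1; rewrite addr0.
exists (`|v|^-1 *: v); split; [exact: WV | | by move=> i; exact: WF].
by rewrite normrZ normfV normr_id mulVf // normr_eq0.
Qed.

(** A unit vector of [V] on which the finitely many shallow coordinates vanish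
    has approximants whose shallow coefficients are small; these are dropped. *)
Lemma deep_vector (n : nat) (eta : R) : 0 < eta ->
  exists v s x, [/\ V v, `|v| = 1, uniq s,
    forall d, d \in s -> (n < depth d)%N &
    `|v - \sum_(d <- s) x d *: u d| < eta].
Proof.
move=> eta0; have [D DP] := shallow_nodes n.
have /choice[F FP] := tree_coordinate.
have [v [Vv v1 vD]] := kernel_vector D F.
pose eta' := eta / (size D).+1%:R.
have eta'0 : 0 < eta' by rewrite divr_gt0 // ltr0n.
have [s [x [us near_v]]] := tree_dense v eta'0.
have F_comb d : d \in s -> (F d (\sum_(d <- s) x d *: u d) : R) = x d.
  move=> ds; rewrite linear_sum (bigD1_seq d) //= big1 ?addr0.
    by rewrite linearZ_LR (FP d).2 eqxx /GRing.scale /= mulr1.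
  by move=> d' /negPf nd; rewrite linearZ_LR (FP d).2 nd scaler0.
have In_mem (d : tree) : d \in D -> List.In d D.
  elim: D {DP vD eta' eta'0 near_v} => //= d' D IH.
  by rewrite in_cons => /predU1P[->|/IH]; [left | right].
have x_small d : d \in s -> (depth d <= n)%N -> `|x d| <= eta'.
  move=> ds dn; rewrite -F_comb // -[X in F d X](subrK v) addrC linearD.
  rewrite (vD d) ?add0r; last by apply: In_mem; exact: DP.
  by apply: le_trans ((FP d).1 _) _; rewrite distrC ltW.
exists v, [seq d <- s | (n < depth d)%N], x; split=> //.
- exact: filter_uniq.
- by move=> d; rewrite mem_filter => /andP[].
rewrite big_filter.
have splitE : \sum_(d <- s) x d *: u d =
    \sum_(d <- s | (n < depth d)%N) x d *: u d +
    \sum_(d <- s | (depth d <= n)%N) x d *: u d.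
  rewrite (bigID (fun d => (n < depth d)%N)) /=; congr (_ + _).
  by apply: eq_bigl => d; rewrite -leqNgt.
have -> : v - \sum_(d <- s | (n < depth d)%N) x d *: u d =
    (v - \sum_(d <- s) x d *: u d) + \sum_(d <- s | (depth d <= n)%N) x d *: u d.
  by rewrite splitE opprD addrA subrK.
apply: le_lt_trans (ler_normD _ _) _.
have shallow_le : `|\sum_(d <- s | (depth d <= n)%N) x d *: u d| <=
    (size D)%:R * eta'.
  apply: le_trans (ler_norm_sum _ _ _) _; rewrite -big_filter.
  apply: (@le_trans _ _ (\sum_(d <- [seq d <- s | (depth d <= n)%N]) eta')).
    rewrite big_seq [leRHS]big_seq; apply: ler_sum => d.
    rewrite mem_filter => /andP[dn ds]; rewrite normrZ.
    have -> : `|u d| = 1.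
      have := @tree_norm [:: d] (fun=> 1) isT.
      by rewrite /level_norms !big_seq1 normr1 !scale1r combXn b_norm.
    by rewrite mulr1; exact: x_small.
  rewrite big_const_seq count_predT iter_addr_0 -[leLHS]mulr_natl.
  apply: ler_wpM2r; first exact: ltW.
  rewrite ler_nat; apply: uniq_leq_size; first exact: filter_uniq.
  by move=> d; rewrite mem_filter => /andP[/DP].
apply: (@lt_le_trans _ _ (eta' + (size D)%:R * eta')); first exact: ltr_leD.
have etaE : eta = (size D).+1%:R * eta'.
  by rewrite mulrC divfK // pnatr_eq0.
by rewrite [leRHS]etaE -natr1 mulrDl mul1r addrC.
Qed.

End InfiniteDimensional.
End TreeSpace.

(** * Stopped sums with chosen signs *)

Section StoppedSums.
Variables (R : realType) (T : Type) (eta : R) (g : nat -> T -> R).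

Fixpoint stopped (c : nat -> R) (t : nat) (x : T) : R :=
  if t is t'.+1 then
    stopped c t' x + (`|stopped c t' x| <= eta)%R%:R * (c t' * g t' x)
  else 0.

Lemma stopped_sum c t x : stopped c t x =
  \sum_(i < t) (`|stopped c i x| <= eta)%R%:R * (c i * g i x).
Proof. by elim: t => [|t IH]; rewrite ?big_ord0 // big_ord_recr /= -IH. Qed.

Lemma eq_stopped c c' t x y : (forall i, (i < t)%N -> c i = c' i) ->
  (forall i, (i < t)%N -> g i x = g i y) -> stopped c t x = stopped c' t y.
Proof.
elim: t => [//|t IH] cc gg /=; rewrite IH => [|i it|i it].
- by rewrite cc // gg.
- by apply: cc; rewrite ltnS ltnW.
- by apply: gg; rewrite ltnS ltnW.
Qed.

Definition signs (c : nat -> R) : Prop := forall t, `|c t| = 1.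

Lemma stopped_bound c t x (delta : R) : signs c -> 0 <= eta -> 0 <= delta ->
  (forall i, (i < t)%N -> `|g i x| <= delta) ->
  `|stopped c t x| <= eta + delta.
Proof.
move=> c1 eta0 delta0; elim: t => [|t IH] gd /=.
  by rewrite normr0 addr_ge0.
have IH' : `|stopped c t x| <= eta + delta.
  by apply: IH => i it; apply: gd; rewrite ltnS ltnW.
have [S_le|_] := boolP (`|stopped c t x| <= eta); last by rewrite mul0r addr0.
rewrite mul1r; apply: le_trans (ler_normD _ _) _; apply: lerD => //.
by rewrite normrM c1 mul1r gd.
Qed.

(** Random signs would make the expected square of a stopped sum at most the
    sum of the squares; here the signs are chosen one at a time so that the
    weighted cross term never increases the total. *)
Lemma greedy_signs (I : Type) (s : seq I) (p : I -> R) (j : I -> nat)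
    (pt : I -> T) : (forall i, 0 <= p i) ->
  exists c, signs c /\
    \sum_(i <- s) p i * stopped c (j i) (pt i) ^+ 2 <=
    \sum_(i <- s) p i * \sum_(t < j i) g t (pt i) ^+ 2.
Proof.
move=> p0.
suff step n : exists c, signs c /\
    \sum_(i <- s) p i * stopped c (minn n (j i)) (pt i) ^+ 2 <=
    \sum_(i <- s) p i * \sum_(t < minn n (j i)) g t (pt i) ^+ 2.
  have [n jn] : exists n, all (fun i => (j i <= n)%N) s.
    elim: s {step} => [|i s [n IH]]; first by exists 0%N.
    exists (maxn (j i) n); rewrite /= leq_maxl /=.
    by apply: sub_all IH => k kn; rewrite leq_max kn orbT.
  have [c [c1 cP]] := step n; exists c; split=> //.
  suff minE (f : nat -> I -> R) : \sum_(i <- s) p i * f (minn n (j i)) i =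
      \sum_(i <- s) p i * f (j i) i.
    rewrite -(minE (fun n i => stopped c n (pt i) ^+ 2)).
    by rewrite -(minE (fun n i => \sum_(t < n) g t (pt i) ^+ 2)).
  elim: s jn {step cP} => [|i s IH] /=; first by rewrite !big_nil.
  by move=> /andP[ji js]; rewrite !big_cons IH // (minn_idPr ji).
elim: n => [|n [c [c1 cP]]].
  exists (fun=> 1); split=> [t|]; first exact: normr1.
  rewrite big1 => [|i _]; last by rewrite min0n /= expr0n mulr0.
  apply: sumr_ge0 => i _; apply: mulr_ge0 => //; apply: sumr_ge0 => t _.
  exact: sqr_ge0.
pose k i : R := (`|stopped c n (pt i)| <= eta)%R%:R.
pose cross : R := \sum_(i <- s | (n < j i)%N)
  p i * (k i * (stopped c n (pt i) * g n (pt i))).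
pose c' t := if t == n then (if 0 <= cross then -1 else 1) else c t.
have c'1 : signs c'.
  move=> t; rewrite /c'; case: eqP => // _.
  by case: ifP => _; rewrite ?normrN1 ?normr1.
exists c'; split=> //.
have c'n_cross : c' n * cross <= 0.
  rewrite /c' eqxx; case: ifP => [cr|/negbT]; first by rewrite mulN1r oppr_le0.
  by rewrite -ltNge mul1r => /ltW.
have c'E m x : (m <= n)%N -> stopped c' m x = stopped c m x.
  move=> mn; apply: eq_stopped => // i im.
  by rewrite /c' ltn_eqF // (leq_trans im).
have term i : p i * stopped c' (minn n.+1 (j i)) (pt i) ^+ 2 <=
    p i * stopped c (minn n (j i)) (pt i) ^+ 2 +
    (n < j i)%:R * (p i * g n (pt i) ^+ 2 +
      2 * (c' n * (p i * (k i * (stopped c n (pt i) * g n (pt i)))))).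
  have [nj|jn] := ltnP n (j i); last first.
    by rewrite (minn_idPr (leqW jn)) ?(minn_idPr jn) c'E // mul0r addr0.
  rewrite (minn_idPl nj) ?(minn_idPl (ltnW nj)) /= c'E // -/(k i) mul1r.
  have c'sq : c' n ^+ 2 = 1 by rewrite -real_normK ?num_real // c'1 expr1n.
  have k01 : k i * k i <= 1 by rewrite /k -natrM mulnb andbb lern1 leq_b1.
  set S := stopped c n (pt i); set G := g n (pt i).
  have -> : p i * (S + k i * (c' n * G)) ^+ 2 =
      p i * S ^+ 2 + (p i * (k i * k i * (c' n ^+ 2 * G ^+ 2)) +
      2 * (c' n * (p i * (k i * (S * G))))) by ring.
  rewrite c'sq mul1r lerD2l lerD2r ler_wpM2l //.
  by rewrite ler_piMl // sqr_ge0.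
apply: (@le_trans _ _ (\sum_(i <- s) (p i * stopped c (minn n (j i)) (pt i) ^+ 2 +
    (n < j i)%:R * (p i * g n (pt i) ^+ 2 +
      2 * (c' n * (p i * (k i * (stopped c n (pt i) * g n (pt i))))))))).
  by apply: ler_sum => i _; exact: term.
rewrite big_split /=.
have -> : \sum_(i <- s) (n < j i)%:R * (p i * g n (pt i) ^+ 2 +
      2 * (c' n * (p i * (k i * (stopped c n (pt i) * g n (pt i)))))) =
    \sum_(i <- s) (n < j i)%:R * (p i * g n (pt i) ^+ 2) + 2 * (c' n * cross).
  have -> : cross = \sum_(i <- s) (n < j i)%:R *
      (p i * (k i * (stopped c n (pt i) * g n (pt i)))).
    rewrite /cross big_mkcond; apply: eq_bigr => i _.
    by case: (n < j i)%N; rewrite ?mul1r ?mul0r.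
  rewrite !mulr_sumr -big_split; apply: eq_bigr => i _ /=.
  by rewrite mulrDr; congr (_ + _); ring.
have -> : \sum_(i <- s) p i * \sum_(t < minn n.+1 (j i)) g t (pt i) ^+ 2 =
    \sum_(i <- s) p i * \sum_(t < minn n (j i)) g t (pt i) ^+ 2 +
    \sum_(i <- s) (n < j i)%:R * (p i * g n (pt i) ^+ 2).
  rewrite -big_split; apply: eq_bigr => i _ /=.
  have [nj|jn] := ltnP n (j i).
    rewrite (minn_idPl nj) ?(minn_idPl (ltnW nj)) big_ord_recr /= mulrDr.
    by rewrite mul1r.
  by rewrite (minn_idPr (leqW jn)) ?(minn_idPr jn) mul0r addr0.
by rewrite addrA ler_wnDr //; [lra | exact: lerD].
Qed.

End StoppedSums.

(** * Functionals that are small on all branches *)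

Definition level (d : tree) : nat := (depth d).-1.

Lemma sum_ord_split (V : nmodType) (m n : nat) (F : nat -> V) : (m <= n)%N ->
  \sum_(i < n) F i = \sum_(i < m) F i + \sum_(i < n | (m <= i)%N) F i.
Proof.
move=> mn; rewrite (bigID (fun i : 'I_n => (i < m)%N)) /=; congr (_ + _).
  by rewrite (big_ord_widen n F mn).
by apply: eq_bigl => i; rewrite -leqNgt.
Qed.

Lemma comb_level_norms (R : realType) (phi : nat -> R) (s : seq tree)
    (x : tree -> R) :
  (comb (phi : nat -> R^o) (level_norms s x) : R) =
  \sum_(d <- s) `|x d| * phi (level d).
Proof.
rewrite /level_norms (linear_sum (comb (phi : nat -> R^o))).
apply: eq_bigr => d _.
rewrite (linearZ_LR (comb (phi : nat -> R^o))); congr (_ * _).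
exact: (combXn (phi : nat -> R^o)).
Qed.

Section TameFunctional.
Variables (R : realType) (E : normedModType R) (b : nat -> E).
Variables (X : completeNormedModType R) (u : tree -> X).
Hypotheses (latB : lattice_norm (fun p => `|comb b p|)) (Xu : is_XB b u).

Variables (cut : nat -> nat) (s : nat -> seq tree) (x : nat -> tree -> R).
Hypotheses (cut0 : cut 0 = 0%N) (cutS : forall j, (cut j < cut j.+1)%N).
Hypothesis s_block : forall j d, d \in s j -> (cut j <= level d < cut j.+1)%N.

Variables (k : nat) (a phi : nat -> R) (eta delta : R).
Hypotheses (a0 : forall j, 0 <= a j) (phi0 : forall i, 0 <= phi i).
Hypothesis phi_le : forall p : {poly R},
  \sum_(i < size p) phi i * `|p`_i| <= `|comb b p|.
Hypothesis phi_flat : forall j (p : {poly R}), (j < k)%N -> in_block cut j p ->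
  \sum_(i < size p) phi i * `|p`_i| <= delta * `|comb b p|.
Hypotheses (eta0 : 0 < eta) (delta0 : 0 < delta).
Hypothesis delta_small : delta <= eta ^+ 2 / 2.

Let y0 : {poly R} := \sum_(j < k) a j *: level_norms (s j) (x j).
Hypothesis y0_phi : 1 / 2 <= comb phi y0 :> R^o.

(** Words that are not nodes of [s j] get the sign 0, which lets the words of
    arbitrary sequences of integers be tested. *)
Definition node_sign (j : nat) (w : seq nat) : R :=
  if insub w is Some d then if (d : tree) \in s j then Num.sg (x j d) else 0
  else 0.

Definition branch_coef (n : nat) (h : nat -> nat) : R :=
  (h n)%:R / 3 ^+ (4 * n.+1).

Definition branch_part (m : nat) (h : nat -> nat) : {poly R} :=
  \poly_(n < m) branch_coef n h.

(** The value on the branch [h] of the part of the functional living in block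
    [t]; it is cut off once the branch has left the unit ball, which does not
    affect the branches that define [setK]. *)
Definition block_value (t : nat) (h : nat -> nat) : R :=
  if `|comb b (branch_part (cut t.+1) h)| <= 1 then
    \sum_(n < cut t.+1 | (cut t <= n)%N)
      node_sign t (mkseq h n.+1) * phi n * branch_coef n h
  else 0.

Lemma branch_coef_ge0 n h : 0 <= branch_coef n h.
Proof. by rewrite divr_ge0 // ?ler0n // exprn_ge0. Qed.

Lemma node_sign_le1 j w : `|node_sign j w| <= 1.
Proof.
rewrite /node_sign; case: insubP => [d _ _|_]; last by rewrite normr0.
case: ifP => _; last by rewrite normr0.
by rewrite normr_sg; case: (_ != 0).
Qed.

Lemma phi_widen (p : {poly R}) n : (size p <= n)%N ->
  \sum_(i < n) phi i * `|p`_i| = \sum_(i < size p) phi i * `|p`_i|.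
Proof.
move=> pn; rewrite (sum_ord_split (fun i => phi i * `|p`_i|) pn) [X in _ + X]big1 ?addr0 // => i pi.
by rewrite nth_default // normr0 mulr0.
Qed.

Lemma branch_part_mono m n h : (m <= n)%N ->
  `|comb b (branch_part m h)| <= `|comb b (branch_part n h)|.
Proof.
have [_ _ Nmono _] := latB => mn; apply: Nmono => i; rewrite !coef_poly.
case: ltnP => im; first by rewrite (leq_trans im mn).
by rewrite normr0 normr_ge0.
Qed.

Lemma phi_branch m h :
  \sum_(n < m) phi n * branch_coef n h <= `|comb b (branch_part m h)|.
Proof.
apply: le_trans (phi_le _); rewrite -(phi_widen (size_poly _ _)).
apply: ler_sum => i _; rewrite coef_poly ltn_ord.
by rewrite ger0_norm // branch_coef_ge0.
Qed.

Lemma block_value_abs t h : `|block_value t h| <=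
  \sum_(n < cut t.+1 | (cut t <= n)%N) phi n * branch_coef n h.
Proof.
have pos n : 0 <= phi n * branch_coef n h by rewrite mulr_ge0 ?branch_coef_ge0.
rewrite /block_value; case: ifP => _; last by rewrite normr0 sumr_ge0.
apply: le_trans (ler_norm_sum _ _ _) _; apply: ler_sum => n _.
rewrite -mulrA normrM [X in _ * X]ger0_norm // ler_piMl //.
exact: node_sign_le1.
Qed.

Lemma block_value_small t h : (t < k)%N -> `|block_value t h| <= delta.
Proof.
have [_ _ Nmono _] := latB.
move=> tk; have [in_ball|out] := boolP (`|comb b (branch_part (cut t.+1) h)| <= 1);
  last by rewrite /block_value (negPf out) normr0 ltW.
apply: le_trans (block_value_abs t h) _.
pose q : {poly R} :=
  \poly_(n < cut t.+1) (if (cut t <= n)%N then branch_coef n h else 0).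
have qb : in_block cut t q.
  move=> i; rewrite coef_poly; case: ltnP => it; last by rewrite eqxx.
  by case: leqP => // _; rewrite eqxx.
apply: (@le_trans _ _ (delta * `|comb b q|)).
  apply: le_trans (phi_flat tk qb).
  rewrite -(phi_widen (size_poly (cut t.+1) _)) big_mkcond.
  apply: ler_sum => i _; rewrite coef_poly ltn_ord; case: ifP => _.
    by rewrite ger0_norm // branch_coef_ge0.
  by rewrite normr0 mulr0.
apply: ler_piMr; first exact: ltW.
apply: le_trans in_ball; apply: Nmono => i.
rewrite !coef_poly; case: ifP => // _; case: ifP => // _.
by rewrite normr0 normr_ge0.
Qed.

(** The blocks that are not cut off form an initial segment, and on it the
    branch lies in the unit ball. *)
Lemma block_value_total m h : \sum_(t < m) `|block_value t h| <= 1.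
Proof.
elim: m => [|m IH]; first by rewrite big_ord0 ler01.
have [in_ball|out] := boolP (`|comb b (branch_part (cut m.+1) h)| <= 1).
  apply: le_trans in_ball; apply: le_trans (phi_branch _ _).
  elim: (m.+1) => [|t IHt]; first by rewrite big_ord0 cut0 big_ord0.
  rewrite big_ord_recr /= (sum_ord_split
    (fun n => phi n * branch_coef n h) (ltnW (cutS t))).
  by apply: lerD => //; exact: block_value_abs.
by rewrite big_ord_recr /= {2}/block_value (negPf out) normr0 addr0.
Qed.

Lemma block_value_squares m h : (m <= k)%N ->
  \sum_(t < m) block_value t h ^+ 2 <= delta.
Proof.
move=> mk; apply: (@le_trans _ _ (\sum_(t < m) delta * `|block_value t h|)).
  apply: ler_sum => t _; rewrite -real_normK ?num_real // expr2.
  by rewrite ler_wpM2r // block_value_small // (leq_trans (ltn_ord t)).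
rewrite -mulr_sumr; apply: ler_piMr; first exact: ltW.
exact: block_value_total.
Qed.

Lemma eq_block_value t h h' : (forall n, (n < cut t.+1)%N -> h n = h' n) ->
  block_value t h = block_value t h'.
Proof.
move=> hh; have coefE n : (n < cut t.+1)%N -> branch_coef n h = branch_coef n h'.
  by move=> nt; rewrite /branch_coef hh.
have partE : branch_part (cut t.+1) h = branch_part (cut t.+1) h'.
  by apply/polyP => i; rewrite !coef_poly; case: ifP => // /coefE.
rewrite /block_value partE; case: ifP => // _; apply: eq_bigr => n _.
rewrite coefE //; congr (node_sign t _ * _ * _).
apply: (@eq_from_nth _ 0%N); rewrite ?size_mkseq // => i i_n.
by rewrite !nth_mkseq // hh // (leq_trans i_n).
Qed.

Let S c t h := stopped eta block_value c t h.

(** Whether [d] is stopped depends only on blocks before the one that contains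
    [d], and their values are determined by the path from the root to [d]. *)
Definition tame_coef (c : nat -> R) (d : tree) : R :=
  \sum_(j < k | (cut j <= level d < cut j.+1)%N)
    c j * node_sign j (val d) * phi (level d) *
      (`|S c j (nth 0%N (val d))| <= eta)%R%:R.

Lemma tame_coef_block c d j : (j < k)%N -> (cut j <= level d < cut j.+1)%N ->
  tame_coef c d = c j * node_sign j (val d) * phi (level d) *
    (`|S c j (nth 0%N (val d))| <= eta)%R%:R.
Proof.
move=> jk dj; rewrite /tame_coef (bigD1 (Ordinal jk)) //= big1 ?addr0 //.
move=> i /andP[di /eqP nij]; case: nij; apply: val_inj.
exact: cut_unique cutS _ _ _ di dj.
Qed.

Lemma tame_coef_le c d : signs c -> `|tame_coef c d| <= phi (level d).
Proof.
move=> c1; have [[j [jk dj]]|none] := pselect (exists j, (j < k)%N /\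
    (cut j <= level d < cut j.+1)%N).
  rewrite (tame_coef_block c jk dj) !normrM c1 mul1r.
  rewrite (ger0_norm (phi0 _)) // -mulrA mulrC -mulrA ler_piMr //.
  by rewrite mulr_ile1 // ?node_sign_le1 // normr_nat lern1 leq_b1.
rewrite /tame_coef big1 ?normr0 // => j dj.
by case: none; exists j; split.
Qed.

(** Along a branch the nodes of block [j] are all kept or all stopped, so the
    functional sums to the stopped sum of the block values. *)
Lemma tame_coef_branch c (h : branch) n : (cut k <= n)%N ->
  (forall m, `|comb b (branch_part m (sval h))| <= 1) ->
  \sum_(i < n) branch_coef i (sval h) * tame_coef c (prefix_node h i) =
  S c k (sval h).
Proof.
move=> kn in_ball; have levelE i : level (prefix_node h i) = i.
  by rewrite /level /depth /= size_map size_iota.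
rewrite (sum_ord_split (fun i => branch_coef i (sval h) *
  tame_coef c (prefix_node h i)) kn) [X in _ + X]big1 ?addr0; last first.
  move=> i ki; rewrite /tame_coef big1 ?mulr0 // => j.
  rewrite levelE => /andP[_ ij].
  have := leq_trans ij (cut_le cutS (ltn_ord j)).
  by rewrite ltnNge ki.
rewrite /S stopped_sum.
suff blocks t : (t <= k)%N ->
    \sum_(i < cut t) branch_coef i (sval h) * tame_coef c (prefix_node h i) =
    \sum_(i < t) (`|stopped eta block_value c i (sval h)| <= eta)%R%:R *
      (c i * block_value i (sval h)) by exact: blocks.
elim: t => [|t IH] tk; first by rewrite cut0 !big_ord0.
rewrite (sum_ord_split (fun i => branch_coef i (sval h) *
  tame_coef c (prefix_node h i)) (ltnW (cutS t))) big_ord_recr /= IH; last exact: ltnW.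
congr (_ + _); rewrite /block_value in_ball !mulr_sumr.
apply: eq_bigr => i ti.
have it : (cut t <= level (prefix_node h i) < cut t.+1)%N.
  by rewrite levelE ti ltn_ord.
rewrite (tame_coef_block c tk it) levelE.
have -> : S c t (nth 0%N (val (prefix_node h i))) = S c t (sval h).
  apply: eq_stopped => // t' t't; apply: eq_block_value => m mt'.
  rewrite /= nth_mkseq // ltnS (leq_trans (ltnW mt')) // (leq_trans _ ti) //.
  exact: cut_le.
rewrite /=; ring.
Qed.

(** The greedy signs bound the weighted squares of the stopped sums by [delta]
    times the total weight, and stopped nodes have a square above [eta ^+ 2]:
    by Chebyshev at most half of the total weight is lost. *)
Lemma tame_functional : exists c (F : {linear X -> R^o}),
  [/\ signs c, forall v, `|F v : R| <= `|v|,
      forall (h : branch) n, (cut k <= n)%N ->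
        (forall m, `|comb b (branch_part m (sval h))| <= 1) ->
        `|F (\sum_(i < n) branch_coef i (sval h) *: u (prefix_node h i)) : R|
          <= eta + delta &
      1 / 4 <= (F (\sum_(j < k) (c j * a j) *:
        \sum_(d <- s j) x j d *: u d) : R)].
Proof.
pose I := [seq (j, d) | j <- iota 0 k, d <- s j].
pose p (i : nat * tree) : R := a i.1 * (phi (level i.2) * `|x i.1 i.2|).
have p_ge0 i : 0 <= p i by rewrite !mulr_ge0.
have sumI (V : nmodType) (f : nat -> tree -> V) :
    \sum_(i <- I) f i.1 i.2 = \sum_(j < k) \sum_(d <- s j) f j d.
  rewrite big_allpairs_dep /= -(big_mkord xpredT
    (fun j => \sum_(d <- s j) f j d)) /index_iota subn0.
  by apply: eq_bigr.
have [c [c1 cP]] := greedy_signs eta block_value I (fun i => i.1)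
  (fun i => nth 0%N (val i.2)) p_ge0.
have [F [Fle Fu]] : exists F : {linear X -> R^o},
    (forall v, `|F v : R| <= `|v|) /\ forall d, (F (u d) : R) = tame_coef c d.
  apply: (tree_functional) => s' x' us'.
  rewrite (tree_norm Xu x' us').
  apply: (@le_trans _ _ (comb phi (level_norms s' x') : R^o)); last first.
    apply: le_trans (phi_le _); rewrite /comb; apply: ler_sum => i _.
    by rewrite /GRing.scale /= mulrC ler_wpM2l // ler_norm.
  rewrite comb_level_norms; apply: le_trans (ler_norm_sum _ _ _) _.
  apply: ler_sum => d _; rewrite normrM mulrC.
  by rewrite ler_wpM2l // tame_coef_le.
exists c, F; split=> //.
  move=> h n kn in_ball; rewrite linear_sum.
  have -> : \sum_(i < n) F (branch_coef i (sval h) *: u (prefix_node h i)) =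
      \sum_(i < n) branch_coef i (sval h) * tame_coef c (prefix_node h i).
    by apply: eq_bigr => i _; rewrite linearZ_LR Fu.
  rewrite tame_coef_branch //; apply: stopped_bound => //; try exact: ltW.
  by move=> i ik; exact: block_value_small.
pose keep (i : nat * tree) := (`|S c i.1 (nth 0%N (val i.2))| <= eta)%R.
have FE : (F (\sum_(j < k) (c j * a j) *: \sum_(d <- s j) x j d *: u d) : R) =
    \sum_(i <- I) p i * (keep i)%:R.
  rewrite (sumI _ (fun j d => p (j, d) * (keep (j, d))%:R)) linear_sum.
  apply: eq_bigr => j _; rewrite linearZ_LR linear_sum scaler_sumr.
  rewrite big_seq [RHS]big_seq; apply: eq_bigr => d ds.
  rewrite linearZ_LR Fu (tame_coef_block c (ltn_ord j) (s_block ds)).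
  rewrite /node_sign valK ds /p /= (normrEsg (x j d)).
  have cc : c j * c j = 1.
    by rewrite -expr2 -real_normK ?num_real // c1 expr1n.
  rewrite /GRing.scale /= /keep /=.
  rewrite -[RHS]mul1r -cc; ring.
have sum_p : \sum_(i <- I) p i = (comb phi y0 : R^o).
  rewrite (sumI _ (fun j d => p (j, d))) /y0.
  rewrite (linear_sum (comb (phi : nat -> R^o))); apply: eq_bigr => j _.
  transitivity (a j * \sum_(d <- s j) `|x j d| * phi (level d)); last first.
    by rewrite -comb_level_norms; exact/esym/(linearZ_LR (comb (phi : nat -> R^o))).
  by rewrite mulr_sumr; apply: eq_bigr => d _; rewrite /p /= [phi _ * _]mulrC.
have sum_p_ge : 1 / 2 <= \sum_(i <- I) p i by rewrite sum_p.
have lost : \sum_(i <- I) p i * (1 - (keep i)%:R) <= 1 / 2 * \sum_(i <- I) p i.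
  apply: (@le_trans _ _ (\sum_(i <- I) p i *
      (S c i.1 (nth 0%N (val i.2)) ^+ 2 / eta ^+ 2))).
    apply: ler_sum => i _; rewrite ler_wpM2l //.
    have [_|] := boolP (keep i).
      by rewrite subrr divr_ge0 // sqr_ge0.
    rewrite /keep -ltNge => out.
    rewrite subr0 ler_pdivlMr ?exprn_gt0 // mul1r -[leRHS]real_normK ?num_real //.
    by apply: lerXn2r; rewrite ?nnegrE ?normr_ge0 //; exact: ltW.
  have -> : \sum_(i <- I) p i * (S c i.1 (nth 0%N (val i.2)) ^+ 2 / eta ^+ 2) =
      (\sum_(i <- I) p i * S c i.1 (nth 0%N (val i.2)) ^+ 2) / eta ^+ 2.
    by rewrite mulr_suml; apply: eq_bigr => i _; rewrite mulrA.
  rewrite ler_pdivrMr ?exprn_gt0 //; apply: le_trans cP _.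
  have -> : 1 / 2 * (\sum_(i <- I) p i) * eta ^+ 2 =
      \sum_(i <- I) p i * (eta ^+ 2 / 2) by rewrite -mulr_suml; field.
  rewrite big_seq [leRHS]big_seq; apply: ler_sum => i /allpairsPdep[j [d [ji ds ->]]].
  rewrite ler_wpM2l // (le_trans _ delta_small) // block_value_squares //=.
  by move: ji; rewrite mem_iota add0n => /ltnW.
have : \sum_(i <- I) p i * (1 - (keep i)%:R) =
    \sum_(i <- I) p i - \sum_(i <- I) p i * (keep i)%:R.
  by rewrite -sumrB; apply: eq_bigr => i _; rewrite mulrBr mulr1.
by rewrite FE => eq_lost; lra.
Qed.

End TameFunctional.

(** * A functional that is small on K and large on the subspace *)

Lemma geometric_half (R : realType) (n : nat) :
  \sum_(j < n) (1 / 2 : R) ^+ j = 2 - 2 * (1 / 2) ^+ n.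
Proof.
elim: n => [|n IH]; first by rewrite big_ord0 expr0; lra.
by rewrite big_ord_recr /= IH exprS; lra.
Qed.

Section ThinWitness.
Variables (R : realType) (E : normedModType R) (b : nat -> E).
Variables (X : completeNormedModType R) (u : tree -> X).
Hypotheses (latB : lattice_norm (fun p => `|comb b p|)) (Xu : is_XB b u).
Hypothesis b_norm : forall n, `|b n| = 1.
Hypothesis nosplit : forall C w, 0 <= C -> block_seq w ->
  ~ indexed_splitting (fun p => `|comb b p|) C w.

Lemma branch_norm (h : branch) n :
  `|\sum_(i < n) branch_coef R i (sval h) *: u (prefix_node h i)| =
  `|comb b (branch_part R n (sval h))|.
Proof.
have levelE i : level (prefix_node h i) = i.
  by rewrite /level /depth /= size_map size_iota.
pose s := [seq prefix_node h i | i <- iota 0 n].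
have us : uniq s.
  by rewrite map_inj_uniq ?iota_uniq // => i j /(congr1 level); rewrite !levelE.
have := tree_norm Xu (fun d => branch_coef R (level d) (sval h)) us.
rewrite /level_norms !big_map -/(index_iota 0 n).
have iotaE : iota 0 n = index_iota 0 n by rewrite /index_iota subn0.
rewrite iotaE !big_mkord => normE.
have <- : \sum_(i < n) branch_coef R (level (prefix_node h i)) (sval h) *:
    u (prefix_node h i) =
    \sum_(i < n) branch_coef R i (sval h) *: u (prefix_node h i).
  by apply: eq_bigr => i _; rewrite levelE.
rewrite normE; congr `|comb b _|; rewrite /branch_part poly_def.
apply: eq_bigr => i _; rewrite -/(level _) levelE.
by rewrite ger0_norm // branch_coef_ge0.
Qed.

Lemma block_norm (cut : nat -> nat) (s : nat -> seq tree)
    (x : nat -> tree -> R) (c : nat -> R) k :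
  (forall j, (cut j < cut j.+1)%N) -> (forall j, uniq (s j)) ->
  (forall j d, d \in s j -> (cut j <= level d < cut j.+1)%N) ->
  `|\sum_(j < k) c j *: \sum_(d <- s j) x j d *: u d| =
  `|comb b (\sum_(j < k) `|c j| *: level_norms (s j) (x j))|.
Proof.
move=> cutS us s_block.
have [S [z [uS _ <- <-]]] : exists S z, [/\ uniq S,
    forall d, d \in S -> (level d < cut k)%N,
    \sum_(d <- S) z d *: u d = \sum_(j < k) c j *: \sum_(d <- s j) x j d *: u d &
    level_norms S z = \sum_(j < k) `|c j| *: level_norms (s j) (x j)].
  elim: k => [|k [S [z [uS S_lt normS levS]]]].
    by exists [::], (fun=> 0); rewrite /level_norms !big_nil !big_ord0.
  have disj d : d \in s k -> d \notin S.
    move=> /s_block/andP[kd _]; apply/negP => /S_lt; by rewrite ltnNge kd.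
  exists (S ++ s k), (fun d => if d \in S then z d else c k * x k d); split.
  - rewrite cat_uniq uS us andbT /=; apply/hasPn => d; exact: disj.
  - move=> d; rewrite mem_cat => /orP[/S_lt|/s_block/andP[]//].
    by move/leq_trans; apply; exact: ltnW.
  - rewrite big_cat big_ord_recr /= -normS; congr (_ + _).
      by rewrite !big_seq; apply: eq_bigr => d ->.
    rewrite scaler_sumr big_seq [RHS]big_seq; apply: eq_bigr => d ds.
    by rewrite (negPf (disj d ds)) scalerA.
  - rewrite /level_norms big_cat big_ord_recr /= -levS; congr (_ + _).
      by rewrite /level_norms !big_seq; apply: eq_bigr => d ->.
    rewrite scaler_sumr big_seq [RHS]big_seq; apply: eq_bigr => d ds.
    by rewrite (negPf (disj d ds)) normrM scalerA.
exact: (tree_norm Xu).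
Qed.

Variable V : set X.
Hypotheses (subV : linear_subspace V) (infV : infinite_dimensional V).

Lemma deep_sequence : exists (cut : nat -> nat) (v : nat -> X)
    (s : nat -> seq tree) (x : nat -> tree -> R),
  [/\ cut 0 = 0%N, forall j, (cut j < cut j.+1)%N, forall j, V (v j),
      (forall j, uniq (s j)) /\
      (forall j d, d \in s j -> (cut j <= level d < cut j.+1)%N) &
      forall j, `|v j| = 1 /\
        `|v j - \sum_(d <- s j) x j d *: u d| <= 1 / 64 * (1 / 2) ^+ j].
Proof.
have /choice[q qP] : forall jn : nat * nat,
    exists w : X * seq tree * (tree -> R),
    [/\ V w.1.1, `|w.1.1| = 1, uniq w.1.2,
      forall d, d \in w.1.2 -> (jn.2 < depth d)%N &
      `|w.1.1 - \sum_(d <- w.1.2) w.2 d *: u d| <= 1 / 64 * (1 / 2) ^+ jn.1].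
  move=> [j n]; have tol : 0 < 1 / 64 * (1 / 2 : R) ^+ j.
    by rewrite mulr_gt0 ?exprn_gt0 //; lra.
  have [v [s [x [Vv v1 us ds near_v]]]] :=
    deep_vector latB Xu b_norm subV infV n tol.
  by exists (v, s, x); split=> //; exact: ltW.
pose cut := fix cut j := if j is j'.+1 then
  maxn (cut j').+1 (\max_(d <- (q (j', cut j')).1.2) depth d) else 0%N.
exists cut, (fun j => (q (j, cut j)).1.1), (fun j => (q (j, cut j)).1.2),
  (fun j => (q (j, cut j)).2).
split=> //.
- by move=> j; rewrite /= leq_max ltnSn.
- by move=> j; have [] := qP (j, cut j).
- split=> [j|j d dq]; first by have [] := qP (j, cut j).
  have [_ _ _ /(_ d dq) deep _] := qP (j, cut j).
  have depthE : (level d).+1 = depth d by rewrite prednK // depth_gt0.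
  rewrite -ltnS depthE deep /= leq_max.
  by apply/orP; right; exact: leq_bigmax_seq.
- by move=> j; have [] := qP (j, cut j).
Qed.

Lemma thin_witness (eps : R) : 0 < eps ->
  exists y (F : {linear X -> R^o}),
    [/\ V y, `|y| <= 1, forall v, `|F v : R| <= `|v|,
        1 / 16 <= (F y : R) & forall z, setK u z -> `|F z : R| <= eps].
Proof.
move=> eps0; have [ND NZ Nmono Ninj] := latB.
have [cut [v [s [x [cut0 cutS Vv [us s_block] v_near]]]]] := deep_sequence.
pose v' j := \sum_(d <- s j) x j d *: u d.
have v'_ge j : 1 / 2 <= `|v' j|.
  have [v1 near_v] := v_near j.
  have := ler_normD (v j - v' j) (v' j); rewrite subrK v1.
  have : (1 / 2 : R) ^+ j <= 1 by apply: exprn_ile1; lra.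
  by move: near_v; rewrite -/(v' j) => *; lra.
pose w j := level_norms (s j) (x j).
have w_norm j : `|comb b (w j)| = `|v' j| by rewrite -(tree_norm Xu).
have w0 j : nonneg (w j).
  by move=> i; rewrite level_norms_coef sumr_ge0.
have wb j : in_block cut j (w j).
  move=> i; rewrite level_norms_coef => ne.
  have [[d [ds di]]|none] := pselect (exists d, d \in s j /\ (depth d).-1 == i).
    by have := s_block j d ds; rewrite /level (eqP di).
  case/eqP: ne; rewrite big_seq_cond big1 // => d /andP[ds di].
  by case: none; exists d.
have bw : block_seq w.
  split=> // [j|j l i i' jl /wb/andP[_ ij] /wb/andP[li _]].
    apply/eqP => wj0; have := w_norm j; rewrite wj0 linear0 normr0 => vj0.
    by have := v'_ge j; rewrite -vj0 => *; lra.
  by apply: leq_trans ij (leq_trans (cut_le cutS jl) li).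
pose eta := eps / 2.
have eta0 : 0 < eta by rewrite divr_gt0.
pose delta := Num.min eta (eta ^+ 2 / 2).
have delta0 : 0 < delta by rewrite lt_min eta0 divr_gt0 // exprn_gt0.
have [k [a [phi [a0 phi0 y0_norm [phi_le phi_flat] y0_phi]]]] :=
  flat_functional latB nosplit cutS bw wb delta0.
have delta_small : delta <= eta ^+ 2 / 2 by rewrite ge_min lexx orbT.
have [c [F [c1 Fle F_branch F_big]]] := tame_functional latB Xu cut0 cutS
  s_block a0 phi0 phi_le phi_flat eta0 delta0 delta_small y0_phi.
have aj_le2 j : (j < k)%N -> a j <= 2.
  move=> jk; have : `|comb b (a j *: w j)| <= 1.
    rewrite -y0_norm; apply: (latN_mono latB).
      by move=> i; rewrite coefZ mulr_ge0 // w0.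
    move=> i; rewrite (bigD1 (Ordinal jk)) //= addrAC subrr add0r coef_sum.
    by rewrite sumr_ge0 // => l _; rewrite coefZ mulr_ge0 // w0.
  rewrite linearZ /= normrZ ger0_norm // w_norm => le1.
  by have := ler_wpM2l (a0 j) (v'_ge j) => *; lra.
pose y := \sum_(j < k) (c j * a j) *: v j.
pose y' := \sum_(j < k) (c j * a j) *: v' j.
have y'_norm : `|y'| = 1.
  rewrite /y' (block_norm x (fun j => c j * a j) k cutS us s_block) // -y0_norm; congr `|comb b _|.
  by apply: eq_bigr => j _; rewrite normrM c1 mul1r ger0_norm.
(* The tolerances in [deep_sequence] sum to 1/32, and [a j <= 2]. *)
have y_near : `|y - y'| <= 1 / 16.
  rewrite /y /y' -sumrB; apply: le_trans (ler_norm_sum _ _ _) _.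
  apply: (@le_trans _ _ (\sum_(j < k) 1 / 32 * (1 / 2) ^+ j)).
    apply: ler_sum => j _.
    have ca : `|c j * a j| = a j by rewrite normrM c1 mul1r ger0_norm.
    rewrite -scalerBr normrZ ca.
    apply: (@le_trans _ _ (2 * (1 / 64 * (1 / 2) ^+ j))); last by lra.
    by apply: ler_pM => //; [exact: aj_le2 | exact: (v_near j).2].
  rewrite -mulr_sumr geometric_half.
  have : 0 < (1 / 2 : R) ^+ k by apply: exprn_gt0; lra.
  by move=> *; lra.
have Vy : V y.
  rewrite /y; elim: (k) => [|n IH]; first by rewrite big_ord0; exact: subV.1.
  by rewrite big_ord_recr /= addrC; apply: subV.2.
(* [|y| <= 17/16], and [F y >= 1/4 - 1/16]; halving leaves room in both. *)
exists ((1 / 2) *: y), F; split=> //.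
- by rewrite -[_ *: _]addr0; apply: subV.2 => //; exact: subV.1.
- rewrite normrZ ger0_norm; last by lra.
  have := ler_normD (y - y') y'; rewrite subrK y'_norm => *; lra.
- have Fy : (F ((1 / 2) *: y) : R) = 1 / 2 * F y by rewrite linearZ_LR.
  have FD : (F y : R) = F (y - y') + F y' by rewrite -linearD subrK.
  have := Fle (y - y'); rewrite ler_norml => /andP[low _].
  rewrite Fy FD; move: F_big; rewrite -/y' => *; lra.
- move=> z [z1 [h hz]].
  pose S n := \sum_(i < n) branch_coef R i (sval h) *: u (prefix_node h i).
  have Sz : S n @[n --> \oo] --> z.
    have -> : (fun n => S n) = series (fun n =>
        ((sval h n)%:R / (3 ^+ (4 * n.+1) : R)) *: u (prefix_node h n)).
      by apply/funext => n; rewrite /series /= big_mkord.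
    exact: hz.
  have in_ball m : `|comb b (branch_part R m (sval h))| <= 1.
    apply: le_trans z1; apply: (cvgr_to_ge (cvg_norm Sz)).
    exists m => // n /= mn; rewrite branch_norm.
    exact: branch_part_mono.
  apply/ler_addgt0Pr => e e0.
  have /cvgrPdist_lt/(_ e e0)[n _ nP] := Sz.
  pose m := maxn n (cut k).
  have := F_branch h m (leq_maxr _ _) in_ball; rewrite -/(S m) => FS.
  have zS : `|z - S m| < e by apply: nP; exact: leq_maxl.
  have -> : F z = F (z - S m) + F (S m) by rewrite -linearD subrK.
  apply: le_trans (ler_normD _ _) _; have := Fle (z - S m).
  have : delta <= eta by rewrite ge_min lexx.
  by rewrite /eta in FS *; move=> *; lra.
Qed.

End ThinWitness.

(** * Thinness *)

Section ThinSet.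
Variables (R : realType) (X : completeNormedModType R).

Lemma closure_ball (A : set X) x : closure A x <->
  forall e : R, 0 < e -> exists2 y, A y & `|x - y| < e.
Proof.
split=> [Ax e e0|Ax B /nbhs_ballP[e e0 eB]].
  have [y [Ay]] := Ax _ (nbhsx_ballx x e e0).
  by rewrite -ball_normE => xy; exists y.
by have [y Ay xy] := Ax e e0; exists y; split=> //; apply: eB; rewrite -ball_normE.
Qed.

Lemma sublevel_convex (p : X -> R) (e : R) : sublinear p ->
  convex_set [set x | p x <= e].
Proof.
move=> [pD pZ] x y t; rewrite !inE /= => px py.
have t0 : 0 <= t%:num by [].
have t1 : 0 <= 1 - t%:num by rewrite subr_ge0 le1.
change (p (t%:num *: x + (1 - t%:num) *: y) <= e).
apply: le_trans (pD _ _) _; apply: le_trans (lerD (pZ _ _ t0) (pZ _ _ t1)) _.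
apply: le_trans (lerD (ler_wpM2l t0 px) (ler_wpM2l t1 py)) _.
by rewrite -mulrDl addrC subrK mul1r.
Qed.

Variable u : tree -> X.

Let gens : set X := setK u `|` [set - x | x in setK u].

Lemma gens_opp x : gens x -> gens (- x).
Proof.
by case=> [Kx|[y Ky <-]]; [right; exists x | left; rewrite opprK].
Qed.

Lemma hull_convex (A : set X) : convex_set (convex_hull A).
Proof.
move=> x y t; rewrite !inE => hx hy C [cC AC].
have := cC x y t; rewrite !inE; apply; [exact: hx|exact: hy].
Qed.

Lemma hull_opp x : convex_hull gens x -> convex_hull gens (- x).
Proof.
move=> hx; apply: (hx [set y | convex_hull gens (- y)]); split.
  move=> y z t; rewrite !inE /= => hy hz.
  have := @hull_convex gens (- y) (- z) t; rewrite !inE => /(_ hy hz).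
  by change (convex_hull gens (t%:num *: - y + (1 - t%:num) *: - z) ->
    convex_hull gens (- (t%:num *: y + (1 - t%:num) *: z)));
    rewrite !scalerN -opprD.
by move=> y /gens_opp gy C [_]; apply.
Qed.

(** Sublevel sets of [p] are convex, and [p <= |.|] lets the bound pass to the
    closure. *)
Lemma setW_le (p : X -> R) (e : R) : sublinear p -> (forall x, p x <= `|x|) ->
  (forall x, setK u x -> p x <= e /\ p (- x) <= e) ->
  forall x, setW u x -> p x <= e.
Proof.
move=> sp p1 pK x /closure_ball Wx.
have hull_le y : convex_hull gens y -> p y <= e.
  move=> hy; apply: (hy [set y | p y <= e]); split; first exact: sublevel_convex.
  by move=> z [/pK[]//|[z' /pK[_ ?] <-]].
apply/ler_addgt0Pr => r r0; have [y /hull_le py xy] := Wx r r0.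
have := sp.1 (x - y) y; rewrite subrK.
by have := p1 (x - y) => *; lra.
Qed.

Lemma setW0 : setW u 0.
Proof.
apply: subset_closure => C [_]; apply; left; split; first by rewrite normr0.
have zero_bound i : ((fun=> 0%N : nat) i <= 3 ^ (4 * i.+1))%N by [].
exists (exist _ (fun=> 0%N) zero_bound) => /=.
apply: cvg_near_cst; apply: nearW => n.
by rewrite /series /= big1 // => i _; rewrite mul0r scale0r.
Qed.

Lemma setW_shape : [/\ setW u !=set0, bounded_set (setW u),
  convex_set (setW u) & forall x, setW u x -> setW u (- x)].
Proof.
split.
- by exists 0; exact: setW0.
- exists 1; split=> [|r /ltW r1 x Wx]; first exact: num_real.
  apply: le_trans r1; move: x Wx; apply: setW_le => //.
    by split=> [y z|t y t0]; [exact: ler_normD | rewrite normrZ ger0_norm].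
  by move=> y [y1 _]; rewrite normrN.
- move=> x y t; rewrite !inE => /closure_ball Wx /closure_ball Wy.
  apply/closure_ball => e e0.
  have [x' hx' xx'] := Wx e e0; have [y' hy' yy'] := Wy e e0.
  exists (t%:num *: x' + (1 - t%:num) *: y').
    by have := @hull_convex gens x' y' t; rewrite !inE; apply.
  change (`|t%:num *: x + (1 - t%:num) *: y -
    (t%:num *: x' + (1 - t%:num) *: y')| < e).
  have t0 : 0 <= t%:num by [].
  have t1 : 0 <= 1 - t%:num by rewrite subr_ge0 le1.
  rewrite opprD addrACA -!scalerBr; apply: le_lt_trans (ler_normD _ _) _.
  rewrite !normrZ (ger0_norm t0) (ger0_norm t1).
  pose m := Num.max `|x - x'| `|y - y'|.
  have me : m < e by rewrite gt_max xx'.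
  apply: le_lt_trans me.
  have xm : `|x - x'| <= m by rewrite le_max lexx.
  have ym : `|y - y'| <= m by rewrite le_max lexx orbT.
  apply: le_trans (lerD (ler_wpM2l t0 xm) (ler_wpM2l t1 ym)) _.
  by rewrite -mulrDl addrC subrK mul1r.
- move=> x /closure_ball Wx; apply/closure_ball => e e0.
  have [y hy xy] := Wx e e0; exists (- y); first exact: hull_opp.
  by rewrite -opprD normrN.
Qed.

(** The set whose infimum is the gauge contains [a^-1] because 0 is in [W]; this
    matters since the infimum of the empty set is 0. *)
Lemma gauge_ge (a r e rho G : R) (F : {linear X -> R^o}) (y : X) :
  0 < a -> 0 < r -> (forall v, `|F v : R| <= `|v|) ->
  (forall z, setW u z -> (F z : R) <= e) -> `|y| <= 1 -> rho <= (F y : R) ->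
  0 < rho -> r * e + a <= rho / G -> 0 < G ->
  G <= minkowski_gauge (fattened (setW u) r a) y.
Proof.
move=> a0 r0 F1 FW y1 Fy rho0 small G0; apply: lb_le_inf.
  exists a^-1; split; first by rewrite /= invr_gt0.
  exists (a *: y); last by rewrite scalerA mulVf ?scale1r // gt_eqF.
  exists 0; first exact: setW0.
  by exists y => //; rewrite scaler0 add0r.
move=> t [/= t0 [_ [w Ww [z z1 <-]] yE]].
have FE : (F y : R) = t * (r * F w + a * F z).
  by rewrite yE linearZ_LR linearD !linearZ_LR.
have Fz : (F z : R) <= 1.
  by apply: le_trans (ler_norm _) _; apply: le_trans (F1 z) _.
have inner : r * F w + a * F z <= rho / G.
  apply: le_trans small; apply: lerD; first by rewrite ler_pM2l // FW.
  by rewrite -[leRHS]mulr1 ler_pM2l.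
have : rho <= t * (rho / G).
  by apply: le_trans Fy _; rewrite FE ler_pM2l.
rewrite mulrCA -[leLHS]mulr1 ler_pM2l // -ler_pdivrMr ?invr_gt0 //.
by rewrite invrK mul1r.
Qed.

End ThinSet.

Theorem theorem4p20 (R : realType) (A : completeNormedModType R) (e : nat -> A)
    (A_reflexive : reflexive_space A)
    (e_basis : one_unconditional_basis e) :
  exists (B : set A) (b : nat -> A) (a : nat -> R),
    [/\ block_subspace e B b,
        null_positive a &
        forall (X : completeNormedModType R) (u : tree -> X),
          is_XB b u -> thin a (setW u)].
Proof.
have [b [b_block latB nosplit]] := nonsplitting_block_basis e_basis A_reflexive.
have b_norm : forall n, `|b n| = 1 by case: b_block.
exists (closed_span b), b, (fun n => n.+1%:R^-1); split=> //.
  split; last exact: cvg_harmonic.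
  by move=> n; rewrite invr_gt0 ltr0n.
move=> X u Xu; split; first exact: setW_shape.
move=> V subV _ infV; apply/eqyP => G G0.
(* Both [2 ^+ n.+1 * eps] and [n.+1%:R^-1] are to be at most half of
   [1 / 16 / G]. *)
have G32 : 0 < 32 * G by lra.
pose n := Num.bound (32 * G).
have n_large : 32 * G <= n.+1%:R.
  apply: ltW; apply: lt_le_trans (archi_boundP _) _; first exact: ltW.
  by rewrite ler_nat.
have r0 : 0 < 2 ^+ n.+1 :> R by apply: exprn_gt0.
pose eps : R := (32 * G * 2 ^+ n.+1)^-1.
have eps0 : 0 < eps by rewrite invr_gt0 mulr_gt0.
have [y [F [Vy y1 F1 Fy FK]]] := thin_witness latB Xu b_norm nosplit subV infV eps0.
have FW z : setW u z -> (F z : R) <= eps.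
  apply: (@setW_le _ _ _ (fun v => F v : R)).
  - by split=> [v w|t v t0]; rewrite ?linearD ?linearZ_LR.
  - by move=> v; apply: le_trans (ler_norm _) _.
  - move=> v /FK; rewrite ler_norml => /andP[low high]; split=> //.
    by rewrite linearN lerNl.
apply: (@le_trans _ _ (ereal_sup [set (minkowski_gauge
    (fattened (setW u) (2 ^+ n.+1) n.+1%:R^-1) y)%:E | y in V `&` unit_ball X])).
  apply: (@le_trans _ _ (minkowski_gauge
    (fattened (setW u) (2 ^+ n.+1) n.+1%:R^-1) y)%:E); last first.
    by apply: ereal_sup_ubound; exists y.
  have a0 : 0 < n.+1%:R^-1 :> R by rewrite invr_gt0 ltr0n.
  have rho0 : 0 < 1 / 16 :> R by lra.
  rewrite lee_fin; apply: (gauge_ge a0 r0 F1 FW y1 Fy rho0 _ G0).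
  have -> : 2 ^+ n.+1 * eps = (32 * G)^-1.
    by rewrite /eps [X in _ / X]mulrC invfM mulrA mulfV ?mul1r // gt_eqF.
  have -> : 1 / 16 / G = (32 * G)^-1 + (32 * G)^-1.
    by field; rewrite gt_eqF.
  by rewrite lerD2l lef_pV2 ?posrE ?ltr0n.
by apply: ereal_sup_ubound; exists n.
Qed.
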